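(* Let $D$ be a link diagram of an oriented link $L$. Let $s_0$ be a Kauffman state of $D$ such that all the blue scars in $s_0D$ are grouped into $k$ ladders $H_1,\dots,H_k$ of heights $h_i\ge 2$, $i=1,\dots,k$. Suppose that: 1. All the ladders have periphery number one. 2. There exists a ladder $H_l$ with height $h_l\ge 3$. 3. All the red scars of $s_0D$ become bichords when all the ladders are broken; precisely, all the red scars of $s_0D$ become bichords in $s_1D$, where $s_1$ is obtained from $s_0$ by changing into red one blue step of each ladder $H_i$, $i=1,\dots,k$. Then there is an order two torsion element in the Khovanov homology of $L$. Precisely, if $\mu_1,\dots,\mu_k$ are integers with $2\le \mu_i\le h_i$ for $i=1,\dots,k$, and there exists $r\in\{1,\dots,k\}$ such that $\mu_r$ is even and $\mu_r<h_r$, then the class $[V]$ of the chain $$V=V(\mu_1,\dots,\mu_k)=\sum_{\substack{i\in\{1,\dots,k\}\\ \mu_i \text{ even},\ \mu_i<h_i}}(-1)^{\mu_1+\dots+\mu_{i-1}}\, s(\mu_1,\dots,\mu_{i-1},1+\mu_i,\mu_{i+1},\dots,\mu_k;C_i^{0-})$$ is an order two torsion element in $\underline{Kh}^{i,j}(D)$, where $i=i_0+1+\sum_{t=1}^k\mu_t$ and $j=i_0+|s_1D|+2\sum_{t=1}^k\mu_t-k$, $i_0$ being the number of red scars in $s_0D$.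
   Context: Khovanov complex (coefficients in $\mathbb Z$). A Kauffman state of a diagram $D$ is a map $s:\mathrm{Cro}(D)\to\{A,B\}$ on the set of crossings. $sD$ denotes the collection of disjoint simple closed curves (''circles'') obtained by smoothing each crossing according to its label, where the $A$-smoothing joins the two regions swept by rotating the overstrand counterclockwise and the $B$-smoothing joins the other two; at each crossing one keeps a small chord (''scar'') joining the two resulting arcs, blue for an $A$-label and red for a $B$-label. $|sD|$ is the number of circles. A scar is a monochord if both endpoints lie on the same circle and a bichord if they lie on different circles. An enhanced state is a state together with a sign $\pm$ on each circle of $sD$; $\theta(s)=\#(+)-\#(-)$, $i(s)=$ number of $B$-labels, $j(s)=i(s)+\theta(s)$. $C^{i,j}(D)$ is the free module generated by enhanced states with $i(s)=i$, $j(s)=j$. An enhanced state $t$ is adjacent to $s$ if $i(t)=i(s)+1$, $j(t)=j(s)$, the labels agree except at one crossing $x$ where $s(x)=A$, $t(x)=B$, and the signs of the common circles agree (so mergings are $(+,+)\mapsto +$, $(+,-),(-,+)\mapsto -$, and splittings are $+\mapsto(+,-)$ or $(-,+)$, $-\mapsto(-,-)$). With the crossings numbered, $d(s)=\sum_t (-1)^{k(s,t)}t$ over all $t$ adjacent to $s$, where $k(s,t)$ is the number of crossings previous to the change crossing $x$ having a $B$-label in $s$. $\underline{Kh}^{i,j}(D)=\ker(d:C^{i,j}\to C^{i+1,j})/\mathrm{im}(d:C^{i-1,j}\to C^{i,j})$. If $D$ has $p$ positive and $n$ negative crossings, $Kh^{h,q}(L)=\underline{Kh}^{h+n,\,q-p+2n}(D)$.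 Ladders. A (blue) ladder of $s_0D$ of height $h\ge1$ is a maximal disc of $\mathbb R^2$ containing exactly two arcs (of the same circle or of different circles) and $h$ parallel blue scars (the steps) joining the two arcs; maximal means that no larger such disc contains an extra parallel blue scar. Cutting (breaking) a ladder means replacing the two arcs by two caps, one at each end of the ladder, as when changing a step to red. Cut all the ladders of $s_0D$; the one or two resulting circles touching the two ends of $H_i$ form the periphery of $H_i$, and their number (1 or 2) is the periphery number of $H_i$. Notation. The crossings of $D$ are ordered so that first come those of $H_1$ (in the order of its steps along the ladder), then those of $H_2$, etc., and finally the remaining ones. For subsets $M_i\subset\{1,\dots,h_i\}$ of sizes $\mu_i>0$, $s(M_1,\dots,M_k;\,)$ is the Kauffman state obtained from $s_0$ by changing the steps in $M_i$ of $H_i$ to red, for every $i$. In it, $C_i^j$ ($1\le j\le\mu_i-1$) is the intermediate circle between the $j$-th and $(j+1)$-th red steps of $H_i$, and $C_i^0$ is the periphery circle of $H_i$ touching the first red step of $M_i$ (if the periphery number is one it also touches the last one). $s(\mu_1,\dots,\mu_k;C_i^{j-})$ is the sum, over all $M_1,\dots,M_k$ with $|M_t|=\mu_t$, of the enhanced states with underlying state $s(M_1,\dots,M_k;\,)$ in which all circles have sign $+$ except $C_i^j$, which has sign $-$. *)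

(* Defs.v *)
(* boolp is only used for the quotient by the subgroup of boundaries. *)
From HB Require Import structures.
From mathcomp Require Import all_boot all_order all_algebra.
From mathcomp Require Import boolp.

Set Implicit Arguments.
Unset Strict Implicit.
Unset Printing Implicit Defensive.

Import GRing.Theory.
Local Open Scope ring_scope.

(* A link diagram in the plane, up to planar isotopy, as a combinatorial map.

   The four half-edges at a crossing x are the pairs (x, i), i in Z/4, listed
   counterclockwise; 0 and 2 are on the understrand, 1 and 3 on the overstrand.
   dg_edge exchanges the two half-edges of each edge of the projection.

   A pair (x, i) also names the corner at x between the half-edges i and i + 1,
   which lies to the left of the half-edge (x, i) seen from x. dg_region d is
   the region of the plane containing the corner d. Diagrams may be
   disconnected, so a region may have several boundary components; a circle
   component without crossings ("free circle") is recorded by the regions on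
   its two sides.

   Planarity is Euler's formula V - E + F = 1 + C (here E = 2V, and each free
   circle contributes 0 to V - E and 1 to C). Together with connectedness of the
   dual graph it forces genus 0 for every connected component, and the incidence
   graph of components and regions to be a tree. *)
Section PlanarMap.

Variables (X F R : finType) (edge : X * 'Z_4 -> X * 'Z_4).
Variables (reg : X * 'Z_4 -> R) (side : F -> bool -> R).

(* the two regions are on the two sides of an edge or of a free circle *)
Definition dual_adj : rel R := fun a b =>
  [exists d : X * 'Z_4, (a == reg d) && (b == reg (d.1, d.2 - 1))]
  || [exists c : F, exists e : bool, (a == side c e) && (b == side c (~~ e))].

Definition same_component : rel (X * 'Z_4) := fun d d' =>
  (d'.1 == d.1) || (d' == edge d).

Definition ncomponents : nat := (n_comp same_component predT + #|F|)%N.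

End PlanarMap.

Record diagram := Diagram {
  crossing : finType;
  free_circle : finType;
  region : finType;
  outer_region : region;
  dg_edge : crossing * 'Z_4 -> crossing * 'Z_4;
  dg_region : crossing * 'Z_4 -> region;
  dg_side : free_circle -> bool -> region;
  dg_edgeK : involutive dg_edge;
  dg_edge_neq : forall d, dg_edge d != d;
  dg_region_edge : forall d,
    dg_region ((dg_edge d).1, (dg_edge d).2 - 1) = dg_region d;
  dg_dual_connected : forall r r' : region,
    connect (dual_adj dg_region dg_side) r r';
  dg_euler : #|region| = (#|crossing| + ncomponents free_circle dg_edge + 1)%N
}.

(* half-edges, and also corners *)
Notation dart D := (crossing D * 'Z_4)%type.

Section Diagram.

Variable D : diagram.

(* The orientation of free circles is not recorded, since it does not enter the
   numbers of positive and negative crossings. *)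
Record orientation := Orientation {
  outward : dart D -> bool;
  outward_edge : forall d, outward (dg_edge d) = ~~ outward d;
  outward_through : forall d, outward (d.1, d.2 + 2) = ~~ outward d
}.

(* With the understrand running from 0 to 2, the crossing is positive when the
   overstrand runs from 3 to 1. *)
Definition positive_crossing (o : orientation) (x : crossing D) : bool :=
  outward o (x, 1) == outward o (x, 2).

Definition npos (o : orientation) : nat := #|[set x | positive_crossing o x]|.
Definition nneg (o : orientation) : nat := #|[set x | ~~ positive_crossing o x]|.

(* false is the label A (blue scar), true is the label B (red scar) *)
Definition state := {ffun crossing D -> bool}.

(* Rotating the overstrand counterclockwise sweeps the corners 1 and 3, so the
   A-smoothing joins the half-edges 0,1 and 2,3; the B-smoothing joins 1,2
   and 3,0. *)
Definition smooth (s : state) (d : dart D) : dart D :=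
  (d.1, if odd d.2 (+) s d.1 then d.2 - 1 else d.2 + 1).

Definition point := (dart D + free_circle D)%type.

Definition smoothed_adj (s : state) : rel point := fun p q =>
  match p, q with
  | inl d, inl d' => (d' == dg_edge d) || (d' == smooth s d)
  | _, _ => false
  end.

(* A circle of sD is identified with the set of half-edges it runs through, or
   with a singleton if it is a free circle. *)
Definition circle (s : state) (p : point) : {set point} :=
  [set q | connect (smoothed_adj s) p q].

Definition circles (s : state) : {set {set point}} :=
  [set circle s p | p : point].

(* For both labels, the half-edges 0 and 2 lie on the two different arcs joined
   by the scar. *)
Definition bichord (s : state) (x : crossing D) : bool :=
  circle s (inl (x, 0)) != circle s (inl (x, 2)).

Definition red_scars (s : state) : {set crossing D} := [set x | s x].

(* An enhanced state is a state with the set of its negative circles. *)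
Definition enhanced_state :=
  {e : state * {set {set point}} | e.2 \subset circles e.1}.

Definition label (e : enhanced_state) : state := (val e).1.
Definition minus_circles (e : enhanced_state) : {set {set point}} := (val e).2.

Fact enhance_subproof (s : state) (N : {set {set point}}) :
  (s, circles s :&: N).2 \subset circles (s, circles s :&: N).1.
Proof. exact: subsetIl. Qed.

Definition enhance (s : state) (N : {set {set point}}) : enhanced_state :=
  exist _ (s, circles s :&: N) (enhance_subproof s N).

Definition theta (e : enhanced_state) : int :=
  #|circles (label e) :\: minus_circles e|%:Z - #|minus_circles e|%:Z.
Definition idegree (e : enhanced_state) : int := #|red_scars (label e)|%:Z.
Definition jdegree (e : enhanced_state) : int := idegree e + theta e.

(* t is adjacent to e, with change crossing x *)
Definition adjacent (x : crossing D) (e t : enhanced_state) : bool :=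
  [&& idegree t == idegree e + 1,
      jdegree t == jdegree e,
      ~~ label e x,
      label t x,
      [forall y, (y != x) ==> (label t y == label e y)] &
      [forall C in circles (label e) :&: circles (label t),
         (C \in minus_circles t) == (C \in minus_circles e)]].

(* A numbering of the crossings is an enumeration without repetition. *)
Definition numbering (xs : seq (crossing D)) : bool :=
  perm_eq xs (enum (crossing D)).

Definition prior_red (xs : seq (crossing D)) (x : crossing D) (s : state) : nat :=
  #|[set y | s y & (index y xs < index x xs)%N]|.

Definition chain := {ffun enhanced_state -> int}.

Definition delta (e : enhanced_state) : chain := [ffun t => (t == e)%:Z].

(* the linear extension of e |-> \sum_t (-1)^k(e,t) t, t adjacent to e *)
Definition differential (xs : seq (crossing D)) (c : chain) : chain :=
  [ffun t => \sum_e \sum_(x | adjacent x e t)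
     (-1) ^+ prior_red xs x (label e) * c e].

Definition homogeneous (i j : int) (c : chain) : bool :=
  [forall e, (c e != 0) ==> (idegree e == i) && (jdegree e == j)].

Fact differentialB xs : {morph differential xs : c c' / c - c'}.
Proof.
move=> c c'; apply/ffunP => t; rewrite !ffunE -sumrB.
apply: eq_bigr => e _; rewrite -sumrB.
by apply: eq_bigr => x _; rewrite !ffunE mulrBr.
Qed.

Fact homogeneous_closed i j : zmod_closed (homogeneous i j).
Proof.
split=> [|c c' /forallP hc /forallP hc']; apply/forallP => e.
  by rewrite ffunE eqxx.
apply/implyP; rewrite !ffunE => nz.
have [ce0|/(implyP (hc e))//] := eqVneq (c e) 0.
by apply: (implyP (hc' e)); apply: contraNneq nz => ->; rewrite ce0 subr0.
Qed.

End Diagram.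

Section Homology.

Variables (D : diagram) (xs : seq (crossing D)) (i j : int).

Definition is_cycle : {pred chain D} :=
  [pred c | homogeneous i j c && (differential xs c == 0)].

Fact is_cycle_closed : zmod_closed is_cycle.
Proof.
have [h0 hB] := @homogeneous_closed D i j.
split=> [|c c' /andP[hc /eqP dc] /andP[hc' /eqP dc']]; rewrite inE.
  rewrite [X in X && _]h0 -[X in differential _ X](subrr 0) differentialB.
  by rewrite subrr eqxx.
by rewrite [X in X && _](hB _ _ hc hc') differentialB dc dc' subrr eqxx.
Qed.

HB.instance Definition _ :=
  GRing.isZmodClosed.Build (chain D) is_cycle is_cycle_closed.

(* ker (d : C^{i,j} -> C^{i+1,j}) *)
Record cycles := Cycle { cycle_val :> chain D; _ : cycle_val \in is_cycle }.
HB.instance Definition _ := [isSub for cycle_val].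
HB.instance Definition _ := [Choice of cycles by <:].
HB.instance Definition _ := [SubChoice_isSubZmodule of cycles by <:].

(* im (d : C^{i-1,j} -> C^{i,j}) *)
Definition is_boundary : {pred cycles} :=
  [pred z | `[< exists2 c, homogeneous (i - 1) j c
                         & differential xs c = cycle_val z >]].

Fact is_boundary_closed : zmod_closed is_boundary.
Proof.
have [h0 hB] := @homogeneous_closed D (i - 1) j.
split=> [|z z' /asboolP[c hc dc] /asboolP[c' hc' dc']]; apply/asboolP.
  exists 0; first exact: h0.
  by rewrite -[X in differential _ X](subrr 0) differentialB subrr.
exists (c - c'); first exact: hB.
by rewrite differentialB dc dc'.
Qed.

HB.instance Definition _ :=
  GRing.isZmodClosed.Build cycles is_boundary is_boundary_closed.

(* the homology group, before the shift of degrees *)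
Definition uKh : zmodType := @Quotient.quot cycles is_boundary.

Definition homology_class (z : cycles) : uKh := (\pi_(uKh) z)%qT.

End Homology.

Definition Kh (D : diagram) (o : orientation D) (xs : seq (crossing D))
    (h q : int) : zmodType :=
  uKh xs (h + (nneg o)%:Z) (q - (npos o)%:Z + ((nneg o)%:Z *+ 2)).

Definition order_two_torsion (G : zmodType) (x : G) : Prop :=
  x != 0 /\ x *+ 2 = 0.

Section Ladders.

Variables (D : diagram) (s0 : state D).

Definition opposite_corner (a : dart D) : dart D := (a.1, a.2 + 2).

(* The corners a and b are the two corners of a bounded bigonal region of the
   diagram. *)
Definition bigon (a b : dart D) : bool :=
  [&& a != b,
      ((dg_edge a).1, (dg_edge a).2 - 1) == b,
      [set d | dg_region d == dg_region a] == [set a; b],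
      [forall c, forall e, @dg_side D c e != dg_region a] &
      dg_region a != outer_region D].

(* A disc meeting s0D and its scars in exactly two arcs and some parallel blue
   scars is described by the list of its steps, in order along the disc. The
   step x is recorded by the corner (x, p) in front of it; the corner behind it
   is then (x, p + 2). A blue scar separates the corners 1 and 3, so p is odd.
   The part of the disc between two consecutive steps is a region of the
   complement of s0D and its scars bounded by two scars and two arcs, with no
   other scar attached to the arcs: it is a bigonal region of the diagram, whose
   corners are the one in front of the first step and the one behind the second
   step. *)
Definition ladder_disc (w : seq (dart D)) : bool :=
  [&& w != [::],
      all (fun a : dart D => ~~ s0 a.1 && odd a.2) w,
      uniq [seq a.1 | a <- w] &
      sorted (fun a b => bigon a (opposite_corner b)) w].

Definition ladder (w : seq (dart D)) : bool :=
  ladder_disc w &&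
  [forall a, ~~ ladder_disc (a :: w) && ~~ ladder_disc (rcons w a)].

Definition steps (w : seq (dart D)) : seq (crossing D) := [seq a.1 | a <- w].
Definition height (w : seq (dart D)) : nat := size w.

Definition ladder_steps (k : nat) (H : 'I_k -> seq (dart D)) :
  seq (crossing D) := flatten [seq steps (H t) | t <- enum 'I_k].

(* s(M_1, ..., M_k; ) *)
Definition redden (k : nat) (M : 'I_k -> {set crossing D}) : state D :=
  [ffun x => s0 x || [exists t, x \in M t]].

(* The circles touching the two ends of the ladder w, s1 being a state in which
   one step of every ladder has been changed to red: up to isotopy s1D is s0D
   with its ladders cut. *)
Definition periphery (s1 : state D) (w : seq (dart D)) : {set {set point D}} :=
  if w is a :: w' then
    [set circle s1 (inl (opposite_corner a)); circle s1 (inl (last a w'))]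
  else set0.

Definition periphery_number (s1 : state D) (w : seq (dart D)) : nat :=
  #|periphery s1 w|.

(* For w = H_i and M = M_i, the singleton of the circle C_i^j of s. Here j = 0
   gives the periphery circle touching the first red step, and j > 0 the
   intermediate circle between the j-th and (j+1)-th red steps; in both cases it
   is the circle touching the (j+1)-th red step from behind. *)
Definition ladder_circle (s : state D) (w : seq (dart D))
    (M : {set crossing D}) (j : nat) : {set {set point D}} :=
  if onth [seq a <- w | a.1 \in M] j is Some a
  then [set circle s (inl (opposite_corner a))] else set0.

(* s(mu_1, ..., mu_k; C_i^{j-}) *)
Definition ladder_chain (k : nat) (H : 'I_k -> seq (dart D)) (mu : 'I_k -> nat)
    (i : 'I_k) (j : nat) : chain D :=
  \sum_(M : {ffun 'I_k -> {set crossing D}} |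
        [forall t, (M t \subset steps (H t)) && (#|M t| == mu t)])
    delta (enhance (redden M) (ladder_circle (redden M) (H i) (M i) j)).

Definition torsion_chain (k : nat) (H : 'I_k -> seq (dart D))
    (mu : 'I_k -> nat) : chain D :=
  \sum_(i < k | ~~ odd (mu i) && (mu i < height (H i))%N)
    ladder_chain H (fun t => if t == i then (mu t).+1 else mu t) i 0
      *~ (-1) ^+ (\sum_(t < k | (t < i)%N) mu t)%N.

End Ladders.

(* Main.v *)
Require Import Defs.
From HB Require Import structures.
From mathcomp Require Import all_boot all_order all_algebra.
From mathcomp Require Import zify.

Set Implicit Arguments.
Unset Strict Implicit.
Unset Printing Implicit Defensive.

Import GRing.Theory.
Local Open Scope ring_scope.

(** Let W be the sum of the enhanced states without negative circle over the
    states s(M_1, ..., M_k; ) with #|M_t| = mu_t. The class of V is of order two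
    because d W = 2 V, d V = 0, and no boundary is equal to V.

    As soon as every ladder has a red step, each further step changed to red
    splits a circle: the part of a ladder between two red steps is closed up
    by caps into an intermediate circle, separate from everything else
    ([ladder_red_pair]). So above such states the differential only splits
    circles ([cut_all_split]): it sends a state without negative circle to the
    states with one negative circle among the two new ones
    ([differential_all_plus]).

    Hence the coefficient of d W over a state whose ladder i has mu_i + 1 red
    steps is an alternating sum, over these steps, of the two circles that they
    separate. Neighbouring steps share a circle, so the sum telescopes
    ([sum_red_steps]) to the first circle plus (-1)^mu_i times the last one.
    Both are the periphery circle, the periphery number being one, whence 0 or
    twice the term of V ([differential_plus_chain]). The periphery circle has
    to be known in all these states and not only in s1, but cutting a ladder
    further never separates its two ends ([cut_ends]).

    For d V = 0, it suffices that 2 d V = d d W = 0. Two splittings commute: in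
    both orders the circle through one end of each scar becomes negative, as in
    a product of two factors of square zero; and their signs anticommute
    ([differential2_all_plus]).

    For V not to be a boundary, take one state s above s1 with mu_t red steps
    in each ladder and one more in the ladder r. In s every red scar is a
    bichord: for the ladder steps since mu_t >= 2, for the others since this
    holds in s1, which s refines. So the states just below s have one circle
    less, their enhancements in the degree considered have no negative circle,
    and each of them contributes to boundaries two enhanced states over s with
    the same coefficient. The coefficients of a boundary over s thus have an
    even sum ([mass_boundary]), while those of V have sum 1 or -1
    ([mass_torsion_chain]).

    All this uses a numbering that starts with the ladders. For another
    numbering, multiplying each state by the sign of the inversions between
    the two numberings of its red crossings is an isomorphism of complexes
    ([differential_twist]). *)

(** * Circles of a smoothed diagram *)

Lemma even_card_involution (T : finType) (K : {set T}) (g : T -> T) :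
  involutive g -> (forall x, g x != x) -> {homo g : x / x \in K} ->
  ~~ odd #|K|.
Proof.
move=> gK gx; have [n] := ubnP #|K|; elim: n K => // n IHn K.
rewrite ltnS => leKn Kg.
have [->|[x Kx]] := set_0Vmem K; first by rewrite cards0.
have Kgx : g x \in K :\ x by rewrite !inE gx Kg.
rewrite (cardsD1 x) Kx (cardsD1 (g x) (K :\ x)) Kgx addnA oddD /=.
apply: IHn => [|y].
  apply: leq_trans leKn.
  by rewrite (cardsD1 x K) Kx (cardsD1 (g x) (K :\ x)) Kgx !ltnS leqnSn.
rewrite !inE (inj_eq (inv_inj gK)) => /and3P[ygx yx Ky].
by rewrite yx Kg // andbT -(inj_eq (inv_inj gK)) gK.
Qed.

(** Locked, since otherwise the two ends of a scar would be told apart by a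
    computation in Z/4. *)
HB.lock Definition foot (D : diagram) (x : crossing D) (b : bool) : point D :=
  inl (x, if b then 2 else 0).

Section Circles.

Variable D : diagram.
Implicit Types (s : state D) (x y : crossing D) (p q : point D) (d : dart D).

Definition flip s x : state D := [ffun y => (y == x) (+) s y].

Lemma flipE s x y : flip s x y = (y == x) (+) s y. Proof. by rewrite ffunE. Qed.

Lemma flipxx s x : flip s x x = ~~ s x. Proof. by rewrite flipE eqxx. Qed.

Lemma flip_neq s x y : y != x -> flip s x y = s y.
Proof. by rewrite flipE => /negPf->. Qed.

Lemma flipK x : involutive (flip^~ x).
Proof. by move=> s; apply/ffunP=> y; rewrite !flipE addbA addbb. Qed.

Lemma flipC s x y : flip (flip s x) y = flip (flip s y) x.
Proof. by apply/ffunP=> z; rewrite !flipE addbCA. Qed.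

Lemma Z4P (i : 'Z_4) : [\/ i = 0, i = 1, i = 2 | i = 3].
Proof.
case: i => [[|[|[|[|//]]]] lti].
- by apply: Or41; apply/eqP.
- by apply: Or42; apply/eqP.
- by apply: Or43; apply/eqP.
- by apply: Or44; apply/eqP.
Qed.

Lemma smooth_red s x : s x ->
  [/\ smooth s (x, 0) = (x, 3), smooth s (x, 1) = (x, 2),
      smooth s (x, 2) = (x, 1) & smooth s (x, 3) = (x, 0)].
Proof. by rewrite /smooth /= => ->; split; congr pair; apply/eqP. Qed.

Lemma smooth_blue s x : ~~ s x ->
  [/\ smooth s (x, 0) = (x, 1), smooth s (x, 1) = (x, 0),
      smooth s (x, 2) = (x, 3) & smooth s (x, 3) = (x, 2)].
Proof. by rewrite /smooth /= => /negPf->; split; congr pair; apply/eqP. Qed.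

Lemma smoothK s : involutive (smooth s).
Proof.
case=> x i; case sx: (s x).
  have [e0 e1 e2 e3] := smooth_red sx.
  by case: (Z4P i) => ->; rewrite ?(e0, e1, e2, e3).
have [e0 e1 e2 e3] := smooth_blue (negbT sx).
by case: (Z4P i) => ->; rewrite ?(e0, e1, e2, e3).
Qed.

Lemma smooth_neq s d : smooth s d != d.
Proof.
case: d => x i; case sx: (s x).
  have [e0 e1 e2 e3] := smooth_red sx.
  by case: (Z4P i) => ->; rewrite ?(e0, e1, e2, e3) xpair_eqE eqxx.
have [e0 e1 e2 e3] := smooth_blue (negbT sx).
by case: (Z4P i) => ->; rewrite ?(e0, e1, e2, e3) xpair_eqE eqxx.
Qed.

Lemma smooth_flip s x d : d.1 != x -> smooth (flip s x) d = smooth s d.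
Proof. by move=> dx; rewrite /smooth flip_neq. Qed.

Lemma smoothed_sym s : connect_sym (smoothed_adj s).
Proof.
apply: sym_connect_sym => -[d|c] [d'|c'] //=; apply/orP/orP.
  by case=> /eqP->; [left; rewrite dg_edgeK | right; rewrite smoothK].
by case=> /eqP->; [left; rewrite dg_edgeK | right; rewrite smoothK].
Qed.

Lemma connect_edge s d : connect (smoothed_adj s) (inl d) (inl (dg_edge d)).
Proof. by apply: connect1; rewrite /= eqxx. Qed.

Lemma connect_smooth s d : connect (smoothed_adj s) (inl d) (inl (smooth s d)).
Proof. by apply: connect1; rewrite /= eqxx orbT. Qed.

Lemma eq_circleE s p q :
  (circle s p == circle s q) = connect (smoothed_adj s) p q.
Proof.
apply/eqP/idP => [/setP/(_ q)|pq]; first by rewrite !inE connect0.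
by apply/setP=> r; rewrite !inE (same_connect (@smoothed_sym s) pq).
Qed.

Lemma eq_circleP s p q :
  reflect (circle s p = circle s q) (connect (smoothed_adj s) p q).
Proof. by rewrite -eq_circleE; apply: eqP. Qed.

Lemma mem_circle s p : p \in circle s p. Proof. by rewrite inE. Qed.

Lemma circle_in s p : circle s p \in circles s. Proof. exact: imset_f. Qed.

Lemma circle_edge s d : circle s (inl (dg_edge d)) = circle s (inl d).
Proof. by apply/eq_circleP; rewrite smoothed_sym connect_edge. Qed.

Lemma circle_smooth s d : circle s (inl (smooth s d)) = circle s (inl d).
Proof. by apply/eq_circleP; rewrite smoothed_sym connect_smooth. Qed.

Lemma circle_closed s (Z : {pred point D}) p q :
    (forall d, inl d \in Z -> inl (dg_edge d) \in Z) ->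
    (forall d, inl d \in Z -> inl (smooth s d) \in Z) ->
  connect (smoothed_adj s) p q -> (p \in Z) = (q \in Z).
Proof.
move=> Ze Zs; apply: closed_connect.
apply: (intro_closed (@smoothed_sym s)) => -[d|c] [d'|c'] //=.
by case/orP=> /eqP->; [exact: Ze | exact: Zs].
Qed.

(** The strands of the smoothed diagram, cut open at the crossing [x]. *)
Definition away_adj s x : rel (point D) := fun p q =>
  match p, q with
  | inl d, inl d' => (d' == dg_edge d) || (d.1 != x) && (d' == smooth s d)
  | _, _ => false
  end.

Lemma away_sub s x : subrel (connect (away_adj s x)) (connect (smoothed_adj s)).
Proof.
apply: connect_sub => -[d|c] [d'|c'] //= h; apply: connect1 => /=.
by case/orP: h => [->//|/andP[_ ->]]; rewrite orbT.
Qed.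

Lemma away_sub_flip s x :
  subrel (connect (away_adj s x)) (connect (smoothed_adj (flip s x))).
Proof.
apply: connect_sub => -[d|c] [d'|c'] //= h; apply: connect1 => /=.
by case/orP: h => [->//|/andP[xd]]; rewrite orbC smooth_flip // => ->.
Qed.

(** Strands have two ends: cutting at [x] leaves the four half-edges at [x] as
    the ends of the strands through [x]. In a strand, the edges pair off all the
    half-edges, and the smoothings away from [x] pair off those not at [x]; so an
    even number of them are at [x]. *)
Lemma away_other_end s x i :
  exists2 j, j != i & connect (away_adj s x) (inl (x, i)) (inl (x, j)).
Proof.
pose K := [set d | connect (away_adj s x) (inl (x, i)) (inl d)].
have Kedge : {homo @dg_edge D : d / d \in K}.
  move=> d; rewrite !inE => /connect_trans; apply.
  by apply: connect1; rewrite /= eqxx.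
have evenK : ~~ odd #|K|.
  exact: even_card_involution (@dg_edgeK D) (@dg_edge_neq D) Kedge.
have evenK' : ~~ odd #|[set d in K | d.1 != x]|.
  apply: (even_card_involution (@smoothK s) (@smooth_neq s)) => d.
  rewrite !inE => /andP[/connect_trans xd dx]; rewrite dx andbT.
  by apply: xd; apply: connect1; rewrite /= dx eqxx orbT.
have [j /andP[ji Kj]|none] := pickP [pred j | (j != i) && ((x, j) \in K)].
  by exists j => //; rewrite inE in Kj.
suff defK : K = (x, i) |: [set d in K | d.1 != x].
  by move: evenK; rewrite defK cardsU1 !inE eqxx andbF oddD /= evenK'.
apply/setP=> -[y j]; rewrite in_setU1 in_set.
have [->|yx] := eqVneq y x; last by rewrite xpair_eqE (negPf yx) andbT.
rewrite andbF orbF xpair_eqE eqxx /=.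
have [->|ji] := eqVneq j i; first by rewrite inE connect0.
by have /= := none j; rewrite ji.
Qed.

Variables (s : state D) (x : crossing D).
Hypotheses (sx : s x) (bi_x : bichord s x).

Let C0 := circle s (foot x false).
Let C2 := circle s (foot x true).

Lemma bichord_neq : C0 != C2.
Proof. by rewrite /C0 /C2 foot.unlock; exact: bi_x. Qed.

Lemma red_circle0 : circle s (inl (x, 0)) = C0.
Proof. by rewrite /C0 foot.unlock. Qed.

Lemma red_circle2 : circle s (inl (x, 2)) = C2.
Proof. by rewrite /C2 foot.unlock. Qed.

Lemma red_circle3 : circle s (inl (x, 3)) = C0.
Proof. by rewrite -red_circle0 -circle_smooth; have [_ _ _ ->] := smooth_red sx. Qed.

Lemma red_circle1 : circle s (inl (x, 1)) = C2.
Proof. by rewrite -red_circle2 -circle_smooth; have [_ -> _ _] := smooth_red sx. Qed.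

Lemma away_red_ends :
  connect (away_adj s x) (inl (x, 0)) (inl (x, 3)) /\
  connect (away_adj s x) (inl (x, 1)) (inl (x, 2)).
Proof.
split.
  have [j j0 xj] := away_other_end s x 0.
  have /eq_circleP := away_sub xj.
  case: (Z4P j) j0 xj => [->|->|->|->] // _ _;
    rewrite red_circle0 ?red_circle1 ?red_circle2 => C02.
  - by case/eqP: bichord_neq.
  - by case/eqP: bichord_neq.
have [j j1 xj] := away_other_end s x 1.
have /eq_circleP := away_sub xj.
case: (Z4P j) j1 xj => [->|->|->|->] // _ _; rewrite red_circle1 => C20.
- by case/eqP: bichord_neq; rewrite C20 red_circle0.
- by case/eqP: bichord_neq; rewrite C20 red_circle3.
Qed.

Lemma flip_connect_sub :
  subrel (connect (smoothed_adj s)) (connect (smoothed_adj (flip s x))).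
Proof.
have [/away_sub_flip c03 /away_sub_flip c12] := away_red_ends.
have cf_sym := @smoothed_sym (flip s x).
apply: connect_sub => -[[y i]|c] [d'|c'] //=.
case/orP=> /eqP->; first exact: connect_edge.
have [->|yx] := eqVneq y x; last first.
  by rewrite -(@smooth_flip _ x) //; apply: connect_smooth.
have [e0 e1 e2 e3] := smooth_red sx.
by case: (Z4P i) => ->; rewrite ?(e0, e1, e2, e3) // cf_sym.
Qed.

Lemma end_in_merged i : inl (x, i) \in C0 :|: C2.
Proof.
rewrite !inE -!eq_circleE -/C0 -/C2.
by case: (Z4P i) => ->; rewrite (red_circle0, red_circle1, red_circle2, red_circle3)
  eqxx ?orbT.
Qed.

Lemma merged_closed p q :
  connect (smoothed_adj s) p q -> p \in C0 :|: C2 -> q \in C0 :|: C2.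
Proof.
by move=> pq; rewrite !inE => /orP[]/connect_trans->; rewrite ?orbT.
Qed.

(** Away from [x], one strand joins the half-edges 0 and 3 and another one 1
    and 2: any other pairing would put both ends of the scar on one circle. The
    blue smoothing joins 0 to 1 and 2 to 3, which links these two strands into
    a single circle and leaves the other circles alone. *)
Lemma flip_connectE p q :
  connect (smoothed_adj (flip s x)) p q =
  connect (smoothed_adj s) p q || (p \in C0 :|: C2) && (q \in C0 :|: C2).
Proof.
have cs_sym := @smoothed_sym s; have cf_sym := @smoothed_sym (flip s x).
apply/idP/idP.
  pose Z := [pred r | connect (smoothed_adj s) p r
                      || (p \in C0 :|: C2) && (r \in C0 :|: C2)].
  move=> pq; have : p \in Z by rewrite inE connect0.
  have Zedge d : inl d \in Z -> inl (dg_edge d) \in Z.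
    case/orP=> [/connect_trans pd|/andP[Up Ud]]; apply/orP; [left | right].
      exact: pd (connect_edge s d).
    by rewrite Up; apply: merged_closed Ud; apply: connect_edge.
  have Zsmooth d : inl d \in Z -> inl (smooth (flip s x) d) \in Z.
    case: d => y i; have [->|yx] := eqVneq y x.
      case/orP=> [px|/andP[Up _]]; apply/orP; right; rewrite end_in_merged andbT //.
      by apply: merged_closed (end_in_merged i); rewrite cs_sym.
    rewrite smooth_flip //.
    case/orP=> [/connect_trans pd|/andP[Up Ud]]; apply/orP; [left | right].
      exact: pd (connect_smooth s (y, i)).
    by rewrite Up; apply: merged_closed Ud; apply: connect_smooth.
  by rewrite (circle_closed Zedge Zsmooth pq).
case/orP=> [|/andP[Up Uq]]; first exact: flip_connect_sub.
have foot02 : connect (smoothed_adj (flip s x)) (foot x false) (foot x true).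
  have := connect_smooth (flip s x) (x, 0).
  have [|-> _ _ _] := @smooth_blue (flip s x) x; rewrite ?flipxx ?sx // => c01.
  apply: (@connect_trans _ _ (inl (x, 0))).
    by apply: flip_connect_sub; apply/eq_circleP; rewrite red_circle0.
  apply: connect_trans c01 _.
  by apply: flip_connect_sub; apply/eq_circleP; rewrite red_circle1.
have toU r : r \in C0 :|: C2 ->
    connect (smoothed_adj (flip s x)) (foot x false) r.
  rewrite !inE => /orP[]/flip_connect_sub //.
  by apply: connect_trans.
by apply: connect_trans (toU _ Uq); rewrite cf_sym toU.
Qed.

Lemma circle_flip p :
  circle (flip s x) p = if p \in C0 :|: C2 then C0 :|: C2 else circle s p.
Proof.
apply/setP=> q; rewrite [LHS]inE flip_connectE; case: ifP => Up; last first.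
  by rewrite orbF inE.
apply/orb_idl => pq; move: Up; rewrite !inE.
by case/orP=> /connect_trans->; rewrite ?orbT.
Qed.

Lemma circle_flip_end i : circle (flip s x) (inl (x, i)) = C0 :|: C2.
Proof. by rewrite circle_flip end_in_merged. Qed.

Lemma circleP C : reflect (exists p, C = circle s p) (C \in circles s).
Proof.
by apply: (iffP imsetP) => [[p _ ->]|[p ->]]; exists p.
Qed.

Lemma merged_notin : C0 :|: C2 \notin circles s.
Proof.
apply/negP => /circleP[p Ep].
have : foot x false \in C0 :|: C2 by rewrite inE mem_circle.
have : foot x true \in C0 :|: C2 by rewrite inE mem_circle orbT.
rewrite Ep !inE => /eq_circleP p2 /eq_circleP p0.
by case/eqP: bichord_neq; rewrite /C0 /C2 -p0 -p2.
Qed.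

Lemma circles_flip :
  circles (flip s x) = (C0 :|: C2) |: (circles s :\: [set C0; C2]).
Proof.
apply/setP=> C; rewrite in_setU1 in_setD in_set2; apply/imsetP/idP.
  case=> p _ ->; rewrite circle_flip; case: ifP => [_|]; first by rewrite eqxx.
  rewrite !inE => /norP[p0 p2]; rewrite circle_in andbT; apply/orP; right.
  by rewrite !eq_circleE !(smoothed_sym s p) negb_or p0 p2.
case/predU1P => [->|/andP[nC /circleP[p defC]]].
  by exists (inl (x, 0)); rewrite ?circle_flip_end.
exists p => //; rewrite circle_flip ifN // !inE -!eq_circleE -defC.
by rewrite !(eq_sym _ C).
Qed.

Lemma common_circle C : C \in circles s ->
  (C \in circles (flip s x)) = (C != C0) && (C != C2).
Proof.
move=> sC; rewrite circles_flip in_setU1 in_setD in_set2 sC andbT negb_or.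
by case: eqP sC => // ->; rewrite (negPf merged_notin).
Qed.

Lemma card_circles_flip : #|circles s| = #|circles (flip s x)|.+1.
Proof.
rewrite circles_flip cardsU1 in_setD (negPf merged_notin) andbF add1n.
rewrite -(cardsID [set C0; C2] (circles s)).
have /setIidPr -> : [set C0; C2] \subset circles s.
  by rewrite subUset !sub1set !circle_in.
by rewrite cards2 bichord_neq.
Qed.

End Circles.

(** * Ladders *)

Section Ladder.

Variables (D : diagram) (s0 : state D).
Implicit Types (s : state D) (x y : crossing D) (d a b : dart D).

(** Turning around a region from one corner to the next one is injective; it
    preserves the region, so it exchanges the two corners of a bigon. *)
Lemma bigon_edges a b : bigon a b ->
  dg_edge a = (b.1, b.2 + 1) /\ dg_edge b = (a.1, a.2 + 1).
Proof.
case/and5P=> ab /eqP turn_a /eqP/setP reg_a _ _.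
pose turn d := ((dg_edge d).1, (dg_edge d).2 - 1).
have edgeE d : dg_edge d = ((turn d).1, (turn d).2 + 1).
  by rewrite /= subrK -surjective_pairing.
have turn_inj : injective turn.
  move=> d d' Ed; apply: (inv_inj (@dg_edgeK D)).
  by rewrite (edgeE d) (edgeE d') Ed.
have Ea : turn a = b by [].
have : turn b \in [set a; b].
  by rewrite -reg_a inE dg_region_edge -Ea dg_region_edge.
rewrite in_set2 => /orP[] /eqP Eb; first by rewrite !edgeE Ea Eb.
by case/eqP: ab; apply: turn_inj; rewrite Ea Eb.
Qed.

Lemma Z4_oddP (p : 'Z_4) : odd p -> p = 1 \/ p = 3.
Proof. by case: (Z4P p) => -> //; [left | right]. Qed.

Lemma smooth_red_corner s x (p : 'Z_4) : s x -> odd p ->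
  [/\ smooth s (x, p) = (x, p + 1), smooth s (x, p + 1) = (x, p),
      smooth s (x, p + 2) = (x, p + 3) & smooth s (x, p + 3) = (x, p + 2)].
Proof.
by rewrite /smooth /= => -> /Z4_oddP[] ->; split; congr pair; apply/eqP.
Qed.

Lemma smooth_blue_corner s x (p : 'Z_4) : ~~ s x -> odd p ->
  [/\ smooth s (x, p) = (x, p + 3), smooth s (x, p + 1) = (x, p + 2),
      smooth s (x, p + 2) = (x, p + 1) & smooth s (x, p + 3) = (x, p)].
Proof.
by rewrite /smooth /= => /negPf-> /Z4_oddP[] ->; split; congr pair; apply/eqP.
Qed.

Lemma red_corner_foot s x (p : 'Z_4) : s x -> odd p ->
  exists e, circle s (inl (x, p)) = circle s (foot x e) /\
            circle s (inl (x, p + 2)) = circle s (foot x (~~ e)).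
Proof.
move=> sx p_odd; have circ1 := red_circle1 sx; have circ3 := red_circle3 sx.
have [->|->] := Z4_oddP p_odd.
  have -> : 1 + 2 = 3 :> 'Z_4 by apply/eqP.
  by exists true.
have -> : 3 + 2 = 1 :> 'Z_4 by apply/eqP.
by exists false.
Qed.

Lemma bichord_foot s x :
  bichord s x = (circle s (foot x false) != circle s (foot x true)).
Proof. by rewrite foot.unlock. Qed.

Lemma bichord_corner s x (p : 'Z_4) : s x -> odd p ->
  bichord s x = (circle s (inl (x, p)) != circle s (inl (x, p + 2))).
Proof.
move=> sx p_odd; rewrite bichord_foot.
by have [[] [-> ->]] := red_corner_foot sx p_odd; rewrite 1?eq_sym.
Qed.

Section Rungs.

Variable w : seq (dart D).
Hypothesis disc_w : ladder_disc s0 w.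

Lemma ladder_uniq : uniq (steps w).
Proof. by case/and4P: disc_w. Qed.

Lemma ladder_odd a : a \in w -> odd a.2.
Proof. by case/and4P: disc_w => _ /allP w_odd _ _ /w_odd/andP[]. Qed.

Lemma ladder_blue x : x \in steps w -> ~~ s0 x.
Proof.
by case/mapP=> a wa ->; case/and4P: disc_w => _ /allP/(_ a wa)/andP[].
Qed.

Variable z : dart D.

Let X l := (nth z w l).1.
Let P l := (nth z w l).2.

Lemma rung_edges l : (l.+1 < size w)%N ->
  dg_edge (X l, P l) = (X l.+1, P l.+1 + 3) /\
  dg_edge (X l, P l + 1) = (X l.+1, P l.+1 + 2).
Proof.
move=> ltl; case/and4P: disc_w => _ _ _ /(sortedP z)/(_ l ltl)/bigon_edges[] /=.
rewrite -addrA -surjective_pairing /X /P => -> Eb.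
split; last by rewrite -Eb dg_edgeK.
by congr (_, _ + _); apply/eqP.
Qed.

Lemma nth_ladder_odd l : (l < size w)%N -> odd (P l).
Proof. by move=> ltl; rewrite ladder_odd ?mem_nth. Qed.

Lemma index_rung l : (l < size w)%N -> index (X l) (steps w) = l.
Proof.
move=> ltl; have -> : X l = nth z.1 (steps w) l by rewrite (nth_map z).
by rewrite index_uniq ?size_map ?ladder_uniq.
Qed.

(** The half-edges enclosed between the steps [n] and [m]. The difference
    [d.2 - P l] is 0 or 1 for those in front of the step [l], and 2 or 3 for
    those behind it. *)
Definition segment (n m : nat) : pred (point D) := fun q =>
  if q is inl d then
    let l := index d.1 (steps w) in
    if (d.2 - P l == 0) || (d.2 - P l == 1) then (n <= l < m)%N
    else (n < l <= m)%N
  else false.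

Lemma in_segment n m l (i : 'Z_4) : (l < size w)%N ->
  (inl (X l, P l + i) \in segment n m) =
  if (i == 0) || (i == 1) then (n <= l < m)%N else (n < l <= m)%N.
Proof. by move=> ltl; rewrite unfold_in /= index_rung // addrC addKr. Qed.

Lemma segmentP n m q : (n < m < size w)%N -> q \in segment n m ->
  exists l i, [/\ q = inl (X l, P l + i), (l < size w)%N,
                 (i == 0) || (i == 1) -> (n <= l < m)%N &
                 ~~ ((i == 0) || (i == 1)) -> (n < l <= m)%N].
Proof.
case/andP=> ltnm ltm; case: q => // -[y i].
rewrite unfold_in /=; set l := index y _ => seg.
have ltl : (l < size w)%N.
  by case: ifP seg => _ /andP[_]; [move/ltn_trans; apply | move/leq_ltn_trans; apply].
have wy : y \in steps w by rewrite -index_mem size_map.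
have Ey : y = X l by rewrite /X -[RHS](nth_map z z.1 fst) ?nth_index.
exists l, (i - P l); split=> //; first by rewrite {1}Ey addrC subrK.
  by move=> side; rewrite side in seg.
by move/negPf=> side; rewrite side in seg.
Qed.

Lemma segment_edge n m d : (n < m < size w)%N ->
  inl d \in segment n m -> inl (dg_edge d) \in segment n m.
Proof.
move=> nm /segmentP-/(_ nm)[l [i [[->] ltl front back]]].
have ltm : (m < size w)%N by case/andP: nm.
have forth (lm : (n <= l < m)%N) : (l.+1 < size w)%N.
  by apply: leq_ltn_trans ltm; case/andP: lm.
case: (Z4P i) front back => -> /= front back.
- have nlm := front isT; rewrite addr0.
  have [-> _] := rung_edges (forth nlm).
  by rewrite in_segment ?forth // ltnS; case/andP: nlm => -> ->.
- have nlm := front isT.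
  have [_ ->] := rung_edges (forth nlm).
  by rewrite in_segment ?forth // ltnS; case/andP: nlm => -> ->.
- case: l ltl back {front forth} => [|l] ltl /(_ isT) // nlm.
  have [_ El] := rung_edges ltl; rewrite -El dg_edgeK.
  by rewrite in_segment // ltnW.
- case: l ltl back {front forth} => [|l] ltl /(_ isT) // nlm.
  have [El _] := rung_edges ltl; rewrite -El dg_edgeK.
  by rewrite -[P l]addr0 in_segment // ltnW.
Qed.

Lemma segment_smooth s n m d : (n < m < size w)%N -> s (X n) -> s (X m) ->
  inl d \in segment n m -> inl (smooth s d) \in segment n m.
Proof.
move=> nm sn sm /segmentP-/(_ nm)[l [i [[->] ltl front back]]].
have P_odd := nth_ladder_odd ltl.
have [sl|sl] := boolP (s (X l)).
  have [e0 e1 e2 e3] := smooth_red_corner sl P_odd.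
  case: (Z4P i) front back => -> /= front back; rewrite ?addr0 ?(e0, e1, e2, e3).
  - by rewrite in_segment //= front.
  - by rewrite -[P l]addr0 in_segment //= front.
  - by rewrite in_segment //= back.
  - by rewrite in_segment //= back.
have neq_n : n != l by apply: contraNneq sl => <-.
have neq_m : l != m by apply: contraNneq sl => ->.
have [e0 e1 e2 e3] := smooth_blue_corner sl P_odd.
have both : (n < l < m)%N.
  case: (Z4P i) front back => -> /= front back.
  - by have /andP[nl ->] := front isT; rewrite ltn_neqAle neq_n nl.
  - by have /andP[nl ->] := front isT; rewrite ltn_neqAle neq_n nl.
  - by have /andP[-> lm] := back isT; rewrite ltn_neqAle neq_m lm.
  - by have /andP[-> lm] := back isT; rewrite ltn_neqAle neq_m lm.
have in_both j : inl (X l, P l + j) \in segment n m.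
  by case/andP: both => nl lm; rewrite in_segment // nl lm !(ltnW nl, ltnW lm) if_same.
by case: (Z4P i) => ->; rewrite ?addr0 ?(e0, e1, e2, e3) // -[P l]addr0.
Qed.

(** A part of the ladder between two red steps is closed up by caps at both
    ends, whatever the labels in between. *)
Lemma segment_connect s n m p q : (n < m < size w)%N -> s (X n) -> s (X m) ->
  connect (smoothed_adj s) p q -> (p \in segment n m) = (q \in segment n m).
Proof.
move=> nm sn sm; apply: circle_closed => d; first exact: segment_edge.
exact: segment_smooth.
Qed.

Lemma segment_red_step s n m x : (n < m < size w)%N -> s (X n) -> s (X m) ->
    x = X n \/ x = X m ->
  bichord s x /\
  exists e, {subset circle s (foot x e) <= segment n m}.
Proof.
move=> nm sn sm xnm; have /andP[ltnm ltm] := nm; have ltn := ltn_trans ltnm ltm.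
have inC p q : q \in circle s p -> (p \in segment n m) = (q \in segment n m).
  by rewrite inE; apply: segment_connect.
suff [p p_odd] : exists2 p : 'Z_4, odd p & s x /\
    (inl (x, p) \in segment n m) != (inl (x, p + 2) \in segment n m).
  case=> sx neq; split.
    rewrite (bichord_corner sx p_odd); apply: contraNneq neq => E.
    by apply/eqP/inC; rewrite E mem_circle.
  have [i [Ei x_i]] : exists i : 'Z_4, i \in [:: p; p + 2] /\ inl (x, i) \in segment n m.
    have [p_in|p_out] := boolP (inl (x, p) \in segment n m).
      by exists p; rewrite mem_head.
    have [p2_in|p2_out] := boolP (inl (x, p + 2) \in segment n m).
      by exists (p + 2); rewrite in_cons mem_head orbT.
    by rewrite (negPf p_out) (negPf p2_out) in neq.
  have [e E] : exists e, circle s (inl (x, i)) = circle s (foot x e).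
    have [e [E E2]] := red_corner_foot sx p_odd.
    by move: Ei; rewrite !inE => /orP[]/eqP->; [exists e | exists (~~ e)].
  by exists e; rewrite -E => q /inC <-.
case: xnm => ->.
  exists (P n); first exact: nth_ladder_odd.
  by split=> //; rewrite -{1}[P n]addr0 !in_segment //= leqnn ltnm ltnn.
exists (P m); first exact: nth_ladder_odd.
by split=> //; rewrite -{1}[P m]addr0 !in_segment //= ltnm leqnn ltnn andbF.
Qed.

End Rungs.

(** A half-edge from which no intermediate circle of the ladder [w] is
    reached, whatever the labels: one behind the first step, one in front of
    the last step, or one at a crossing outside the ladder. *)
Definition outside (w : seq (dart D)) d :=
  (d.1 \notin steps w) || (d \in [:: opposite_corner (head d w); last d w]).

Lemma outside_segment w z n m d : ladder_disc s0 w -> (n < m < size w)%N ->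
  outside w d -> inl d \notin segment w z n m.
Proof.
move=> disc_w nm; have /andP[ltnm ltm] := nm.
case/orP=> [w'd|].
  rewrite unfold_in /= memNindex // size_map.
  by case: ifP => _; rewrite ?(ltnNge _ m) ?(leqNgt _ m) ?ltm ?(ltnW ltm) andbF.
have w0 : (0 < size w)%N by apply: leq_ltn_trans ltm.
have wlast : ((size w).-1 < size w)%N by rewrite prednK.
rewrite !inE => /orP[] /eqP->.
  rewrite -nth0 (set_nth_default z) // /opposite_corner.
  by rewrite in_segment.
have -> : last d w = nth z w (size w).-1.
  by case: (w) w0 => // a w' _; rewrite (last_nth z).
rewrite [nth _ _ _]surjective_pairing -[_.2]addr0 in_segment //=.
have /leq_gtF-> : (m <= (size w).-1)%N by rewrite -ltnS prednK.
by rewrite andbF.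
Qed.

(** Two red steps cut an intermediate circle off the ladder; so they are
    bichords, and changing one of them to blue only merges an intermediate
    circle into another circle. *)
Lemma ladder_red_pair s w x y : ladder_disc s0 w ->
    x \in steps w -> y \in steps w -> x != y -> s x -> s y ->
  bichord s x /\
  {in outside w &, forall d d',
    connect (smoothed_adj (flip s x)) (inl d) (inl d')
    = connect (smoothed_adj s) (inl d) (inl d')}.
Proof.
move=> disc_w /mapP[a wa ->] /mapP[b wb ->] neq_ab sx sy.
have [n [m [nm sn sm anm]]] : exists n m, [/\ (n < m < size w)%N,
    s (nth a w n).1, s (nth a w m).1 & a.1 = (nth a w n).1 \/ a.1 = (nth a w m).1].
  have [lt_ab|lt_ba|eq_ab] := ltngtP (index a w) (index b w).
  - exists (index a w), (index b w); rewrite lt_ab index_mem wb !nth_index //.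
    by split=> //; left.
  - exists (index b w), (index a w); rewrite lt_ba index_mem wa !nth_index //.
    by split=> //; right.
  - by move: neq_ab; rewrite -(nth_index a wb) -eq_ab nth_index ?eqxx.
have [bi_x [i sub_i]] := segment_red_step disc_w nm sn sm anm.
split=> // d d' out_d out_d'; rewrite flip_connectE //; apply/orb_idr.
have off j e : outside w e -> inl e \in circle s (foot a.1 j) -> j = ~~ i.
  move=> /(outside_segment a disc_w nm)/negP off_e e_j.
  by case: i j sub_i e_j => [] [] sub_i e_j //; case: off_e; apply: sub_i.
case/andP=> /setUP d_U /setUP d'_U; rewrite -eq_circleE.
have [j d_j] : exists j, inl d \in circle s (foot a.1 j).
  by case: d_U; [exists false | exists true].
have [j' d'_j] : exists j, inl d' \in circle s (foot a.1 j).
  by case: d'_U; [exists false | exists true].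
have [Ej Ej'] := (off _ _ out_d d_j, off _ _ out_d' d'_j).
by move: d_j d'_j; rewrite Ej Ej' !inE => /eq_circleP<- /eq_circleP<-.
Qed.

(** Blue steps leave the two rails of a ladder uncut, so that a circle follows
    them from a red step to the next one. *)
Section Rails.

Variable s : state D.

Let front a := circle s (inl a).
Let behind a := circle s (inl (opposite_corner a)).

(* The two rails meet the corner a at the half-edges (a.1, a.2) and
   (a.1, a.2 + 1), joined at a red step; they reach the next corner b from
   behind, at (b.1, b.2 + 3) and (b.1, b.2 + 2). *)
Lemma front_rail a b : bigon a (opposite_corner b) -> odd b.2 ->
  front a = if s b.1 then behind b else front b.
Proof.
case: a b => [x p] [y r] /= /bigon_edges[/= Ea _] r_odd.
rewrite /front -circle_edge Ea /=.
have -> : r + 2 + 1 = r + 3 by rewrite -addrA; congr (_ + _); apply/eqP.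
case: ifPn => sb; rewrite -circle_smooth.
  by have [_ _ _ ->] := smooth_red_corner sb r_odd.
by have [_ _ _ ->] := smooth_blue_corner sb r_odd.
Qed.

Lemma next_red_behind a w : path (fun a b => bigon a (opposite_corner b)) a w ->
    all (fun b => odd b.2) w ->
  circle s (inl (a.1, a.2 + 1)) = behind (head (last a w) [seq b <- w | s b.1]) \/
  ~~ has (fun b => s b.1) w.
Proof.
elim: w a => [|b w IHw] a /=; first by right.
case/andP=> /bigon_edges[_ Eb] b_path /andP[b_odd w_odd].
rewrite -Eb circle_edge; case: ifPn => sb /=; first by left.
have [E|no_red] := IHw b b_path w_odd; last by right.
left; rewrite -E /opposite_corner -circle_smooth.
by have [_ _ -> _] := smooth_blue_corner sb b_odd.
Qed.

Lemma red_front a : s a.1 -> odd a.2 -> front a = circle s (inl (a.1, a.2 + 1)).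
Proof.
case: a => x p /= sx p_odd; rewrite /front -circle_smooth.
by have [-> _ _ _] := smooth_red_corner sx p_odd.
Qed.

Variable w : seq (dart D).
Hypothesis disc_w : ladder_disc s0 w.

Let reds := [seq a <- w | s a.1].

Lemma consecutive_reds : sorted (fun a b => front a == behind b) reds.
Proof.
rewrite /reds; case/and4P: disc_w => _ _ _.
have : all (fun b => odd b.2) w by apply/allP/ladder_odd.
elim: (w) => [|a v IHv] //= /andP[a_odd v_odd] av.
have {IHv} := IHv v_odd (path_sorted av); case: ifPn => // sa.
case E: [seq b <- v | s b.1] => [|b t] //= ->; rewrite andbT red_front //.
have [->|no_red] := next_red_behind av v_odd; first by rewrite E.
by move: no_red; rewrite has_filter E.
Qed.

Lemma first_red_behind a : reds != [::] ->
  behind (head a reds) = behind (head a w).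
Proof.
rewrite -has_filter; rewrite /reds; case/and4P: disc_w => _ _ _.
have : all (fun b => odd b.2) w by apply/allP/ladder_odd.
case: (w) => [|b v] //= /andP[b_odd v_odd] bv; case: ifPn => // sb /= has_red.
have [Eb|] := next_red_behind bv v_odd; last by rewrite has_red.
rewrite [RHS]/behind /opposite_corner -circle_smooth.
have [_ _ -> _] := smooth_blue_corner sb b_odd; rewrite Eb.
by case: [seq _ <- v | _] has_red (has_filter (fun b => s b.1) v) => [->|].
Qed.

Lemma last_red_front a : reds != [::] -> front (last a reds) = front (last a w).
Proof.
have aux b v : path (fun a b => bigon a (opposite_corner b)) b v ->
    all (fun b => odd b.2) v ->
  front (last b [seq c <- v | s c.1]) = front (last b v).
  elim: v b => [|c v IHv] b //= /andP[bc cv] /andP[c_odd v_odd].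
  rewrite -(IHv c) //; case: ifPn => // sc.
  case: [seq _ <- v | _] => //=.
  by rewrite (front_rail bc c_odd) (negPf sc).
rewrite /reds; case/and4P: disc_w => _ _ _.
have : all (fun b => odd b.2) w by apply/allP/ladder_odd.
case: (w) => [|b v] //= /andP[b_odd v_odd] bv.
rewrite -(aux b) //; case: ifPn => // _.
by case: [seq _ <- v | _].
Qed.

End Rails.

End Ladder.
(** * The differential above a state whose blue scars all split *)

Section SplitSets.

Variables (T : finType) (B : {set T}) (c d : T).
Hypotheses (Bc : c \in B) (Bd : d \in B) (neq_cd : c != d).
Implicit Types A E : {set T}.

Lemma agree_off_pair A E : A \subset B ->
  [forall C in B, (C != c) && (C != d) ==> ((C \in A) == (C \in E))]
  = (A :\: [set c; d] == (E :&: B) :\: [set c; d]).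
Proof.
move=> sAB; apply/forall_inP/eqP => [agree|/setP agree C BC].
  apply/setP=> C; rewrite !inE negb_or.
  have [BC|B'C] := boolP (C \in B); last by rewrite (contraNF (subsetP sAB C)) ?andbF.
  by have := agree C BC; case: (C != c); case: (C != d) => //= /eqP->; rewrite andbT.
have := agree C; rewrite !inE negb_or BC andbT.
by case: (C != c); case: (C != d) => //= ->.
Qed.

(** Here [c] and [d] are the two circles created by a splitting and [E] is the
    set of the other negative circles; to preserve the j-degree, exactly one of
    [c] and [d] becomes negative. *)
Lemma pair_extension A E : E :\: [set c; d] = E ->
  (#|A| == #|E|.+1) && (A :\: [set c; d] == E) = (A == c |: E) || (A == d |: E).
Proof.
move=> offE; have E'cd x : x \in [set c; d] -> x \notin E.
  by move=> cd_x; rewrite -offE inE cd_x.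
have [E'c E'd] := (E'cd c (set21 c d), E'cd d (set22 c d)).
have addE x : x \in [set c; d] -> (x |: E) :\: [set c; d] = E.
  by rewrite setDUl -sub1set -setD_eq0 offE => /eqP->; rewrite set0U.
apply/andP/orP => [[/eqP cardA /eqP offA]|]; last first.
  by case=> /eqP->; rewrite cardsU1 ?E'c ?E'd addE ?inE ?eqxx ?orbT.
have /eqP/cards1P[x Ex] : #|A :&: [set c; d]| = 1%N.
  by apply/eqP; rewrite -(eqn_add2r #|E|) add1n -cardA -{1}offA cardsID.
have defA : A = x |: E by rewrite -(setID A [set c; d]) Ex offA.
have : x \in A :&: [set c; d] by rewrite Ex set11.
by rewrite !inE => /andP[_] /orP[]/eqP Dx; [left | right]; rewrite defA Dx.
Qed.

(** When the circle that splits is negative, so are both new circles. *)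
Lemma pair_only A : (#|A| == 2%N) && (A :\: [set c; d] == set0) = (A == [set c; d]).
Proof.
rewrite setD_eq0; apply/andP/eqP => [[/eqP cardA sub]|->].
  by apply/eqP; rewrite eqEcard sub cardA cards2 neq_cd.
by rewrite cards2 neq_cd.
Qed.

End SplitSets.

Lemma deltaE (D : diagram) (e t : enhanced_state D) : delta e t = (t == e)%:Z.
Proof. by rewrite ffunE. Qed.

Definition all_plus (D : diagram) (s : state D) : chain D :=
  delta (enhance s set0).

(** Locked, to keep circles from being compared by computing them. *)
HB.lock Definition one_minus (D : diagram) (s : state D) (p : point D) : chain D :=
  delta (enhance s [set circle s p]).

(** Zero when the two circles coincide, so that negative circles behave like
    factors of square zero in a product. *)
HB.lock Definition two_minus (D : diagram) (s : state D) (p q : point D) : chain D :=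
  if circle s p == circle s q then 0
  else delta (enhance s [set circle s p; circle s q]).

Section Chains.

Variables (D : diagram) (xs : seq (crossing D)).
Implicit Types (s : state D) (x y : crossing D) (p q : point D).
Implicit Types (N : {set {set point D}}) (e t : enhanced_state D) (c : chain D).

HB.instance Definition _ :=
  GRing.isZmodMorphism.Build (chain D) (chain D) (differential xs)
    (differentialB xs).

Lemma chain_mulr2_eq0 c : c *+ 2 = 0 -> c = 0.
Proof.
move=> c2; apply/ffunP=> t; have := ffunMnE c 2 t.
by rewrite c2 !ffunE mulr2n; move: (c t) => z; lia.
Qed.

Lemma theta_card e :
  theta e = #|circles (label e)|%:Z - (#|minus_circles e| * 2)%N%:Z.
Proof.
have sub : minus_circles e \subset circles (label e) := valP e.
rewrite /theta -(cardsID (minus_circles e) (circles (label e))).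
by rewrite (setIidPr sub) muln2 -addnn !PoszD opprD addrACA subrr add0r.
Qed.

Lemma minus_enhance s N : N \subset circles s ->
  minus_circles (enhance s N) = N.
Proof. by move/setIidPr. Qed.

Lemma eq_enhance t s N : N \subset circles s ->
  (t == enhance s N) = (label t == s) && (minus_circles t == N).
Proof.
by move=> /minus_enhance sN; rewrite -(inj_eq val_inj) -pair_eqE /= -{2}sN.
Qed.

Lemma two_minusC s p q : two_minus s p q = two_minus s q p.
Proof. by rewrite two_minus.unlock eq_sym setUC. Qed.

Lemma sum_bool (V : nmodType) (F : bool -> V) : \sum_b F b = F false + F true.
Proof. by rewrite big_bool addrC. Qed.

Section Adjacency.

Variables (s : state D) (x : crossing D).
Hypotheses (sx : s x) (bi_x : bichord s x).

Let C0 := circle s (foot x false).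
Let C2 := circle s (foot x true).

(** A splitting adds one circle, so that the j-degree is preserved when the
    number of negative circles increases by one. *)
Lemma adjacent_split e t : label e = flip s x ->
  adjacent x e t =
  [&& label t == s, #|minus_circles t| == #|minus_circles e|.+1 &
      [forall C in circles s, (C != C0) && (C != C2) ==>
         ((C \in minus_circles t) == (C \in minus_circles e))]].
Proof.
move=> Le; have [Lt|neq_t] := eqVneq (label t) s; last first.
  apply/negP => /and5P[_ _ _ tx /andP[/forallP same _]].
  case/eqP: neq_t; apply/ffunP=> y; have [->|yx] := eqVneq y x.
    by rewrite tx sx.
  by have := same y; rewrite yx Le flip_neq // => /eqP.
have card_red : #|red_scars s| = #|red_scars (flip s x)|.+1.
  rewrite (cardsD1 x) inE sx; congr _.+1; apply: eq_card => y.
  by rewrite !inE flipE; have [->|] := eqVneq y x; rewrite //= sx.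
rewrite /adjacent /jdegree !theta_card /idegree Lt Le flipxx sx /= card_red.
rewrite (card_circles_flip sx bi_x) intS addrC eqxx /=.
rewrite (_ : [forall y, _] = true) /=; last first.
  by apply/forallP=> y; apply/implyP=> yx; rewrite flip_neq.
congr (_ && _); first by apply/eqP/eqP; lia.
apply: eq_forallb => C; rewrite inE andbC.
have [sC|//] := boolP (C \in circles s); rewrite common_circle //=.
Qed.

Lemma minus_sub t : label t = s -> minus_circles t \subset circles s.
Proof. by move<-; exact: (valP t). Qed.

Lemma one_minusE p t : one_minus s p t =
  [&& label t == s & minus_circles t == [set circle s p]]%:Z.
Proof. by rewrite one_minus.unlock deltaE eq_enhance // sub1set circle_in. Qed.

Lemma two_minusE p q t : two_minus s p q t =
  [&& label t == s, circle s p != circle s q &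
      minus_circles t == [set circle s p; circle s q]]%:Z.
Proof.
rewrite two_minus.unlock; case: eqP => [_|_]; first by rewrite ffunE andbF.
by rewrite deltaE eq_enhance // subUset !sub1set !circle_in.
Qed.

Lemma adjacent_all_plus t :
  (adjacent x (enhance (flip s x) set0) t)%:Z
  = \sum_(b : bool) one_minus s (foot x b) t.
Proof.
rewrite sum_bool !one_minusE adjacent_split //.
rewrite minus_enhance ?sub0set //.
have [Lt|//] := eqVneq (label t) s; have subN := minus_sub Lt.
rewrite (agree_off_pair _ _ _ subN) set0I set0D pair_extension ?set0D // !setU0.
rewrite -/C0 -/C2; case: eqP => [->|_]; last by case: eqP.
by rewrite (inj_eq set1_inj) (negPf (bichord_neq bi_x)).
Qed.

Lemma adjacent_one_minus p t :
  (adjacent x (enhance (flip s x) [set circle (flip s x) p]) t)%:Z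
  = \sum_(b : bool) two_minus s p (foot x b) t.
Proof.
rewrite sum_bool !two_minusE adjacent_split // minus_enhance ?sub1set ?circle_in //.
have [Lt|//] := eqVneq (label t) s; have subN := minus_sub Lt.
rewrite (agree_off_pair _ _ _ subN) -/C0 -/C2 /=.
have c02 : C0 != C2 := bichord_neq bi_x.
rewrite circle_flip //; case: ifPn => [Up|].
  rewrite (_ : _ :&: _ = set0); last first.
    by apply/eqP; rewrite setI_eq0 disjoints1 merged_notin.
  rewrite set0D cards1 pair_only //.
  move: Up; rewrite !inE -!eq_circleE -/C0 -/C2 => /orP[]/eqP <-.
    by rewrite eqxx c02 add0r.
  by rewrite eqxx [C2 == C0]eq_sym c02 addr0 setUC.
rewrite !inE -!eq_circleE -/C0 -/C2 negb_or => /andP[p0 p2].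
have off : [set circle s p] :\: [set C0; C2] = [set circle s p].
  apply/setP=> C; rewrite !inE andbC; case: eqP => //= ->.
  by rewrite negb_or !(eq_sym (circle s p)) p0.
rewrite (setIidPl _) ?sub1set ?circle_in // off.
rewrite pair_extension //.
rewrite !(eq_sym (circle s p)) p0 p2 /= ![_ |: [set circle s p]]setUC.
case: eqP => [->|_]; last by case: eqP.
rewrite (_ : (_ == _) = false) //; apply: contraNF c02 => /eqP/setP/(_ C0).
by rewrite !inE eqxx orbT (negPf p0) => /esym.
Qed.

End Adjacency.

Lemma differential_delta e t : differential xs (delta e) t =
  \sum_(x | adjacent x e t) (-1) ^+ prior_red xs x (label e).
Proof.
rewrite ffunE (bigD1 e) //= [X in _ + X]big1 ?addr0 => [|e' ne].
  by apply: eq_bigr => x _; rewrite deltaE eqxx mulr1.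
by rewrite big1 // => x _; rewrite deltaE (negPf ne) mulr0.
Qed.

Definition all_split s := forall x, ~~ s x -> bichord (flip s x) x.

Lemma adjacent_blue x e t : adjacent x e t -> ~~ label e x.
Proof. by case/and5P. Qed.

Lemma differential_all_plus s : all_split s ->
  differential xs (all_plus s) =
  \sum_(x | ~~ s x) (\sum_(b : bool) one_minus (flip s x) (foot x b))
     *~ (-1) ^+ prior_red xs x s.
Proof.
move=> split_s; apply/ffunP=> t; rewrite differential_delta sum_ffunE.
rewrite [RHS](bigID (fun x => adjacent x (enhance s set0) t)) /=.
rewrite [X in _ + X]big1 ?addr0 => [|x /andP[sx /negPf not_adj]].
  rewrite (eq_bigl (fun x => ~~ s x && adjacent x (enhance s set0) t)); last first.
    by move=> x; apply/esym/andb_idl/adjacent_blue.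
  apply: eq_bigr => x /andP[sx adj]; rewrite ffunMzE sum_ffunE.
  rewrite -adjacent_all_plus ?flipxx ?split_s // flipK adj.
  by rewrite -mulrzl mulr1 intz.
rewrite ffunMzE sum_ffunE -adjacent_all_plus ?flipxx ?split_s // flipK not_adj.
exact: mul0rz.
Qed.

Lemma differential_one_minus s p : all_split s ->
  differential xs (one_minus s p) =
  \sum_(x | ~~ s x) (\sum_(b : bool) two_minus (flip s x) p (foot x b))
     *~ (-1) ^+ prior_red xs x s.
Proof.
move=> split_s; rewrite one_minus.unlock; set e := enhance s [set circle s p].
apply/ffunP=> t; rewrite differential_delta sum_ffunE.
rewrite [RHS](bigID (fun x => adjacent x e t)) /=.
have value x : ~~ s x ->
      (\sum_(b : bool) two_minus (flip s x) p (foot x b)) t = (adjacent x e t)%:Z.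
  move=> sx; have sxx : flip s x x by rewrite flipxx.
  by rewrite sum_ffunE -(adjacent_one_minus sxx (split_s x sx)) flipK.
rewrite [X in _ + X]big1 ?addr0 => [|x /andP[sx /negPf not_adj]].
  rewrite (eq_bigl (fun x => ~~ s x && adjacent x e t)); last first.
    by move=> x; apply/esym/andb_idl/adjacent_blue.
  apply: eq_bigr => x /andP[sx adj]; rewrite ffunMzE value // adj.
  by rewrite -mulrzl mulr1 intz.
by rewrite ffunMzE value // not_adj mul0rz.
Qed.

Lemma prior_red_flip s x y : ~~ s x ->
  prior_red xs y (flip s x) = ((index x xs < index y xs) + prior_red xs y s)%N.
Proof.
move=> sx; rewrite /prior_red (cardsD1 x) inE flipxx sx /=; congr (_ + _)%N.
apply: eq_card => z; rewrite !inE flipE.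
by have [->|] := eqVneq z x; rewrite //= (negPf sx).
Qed.

(** Of two crossings, the one that comes first in the numbering changes the
    sign of the other one when it turns red, and not conversely. *)
Lemma prior_red_swap s x y : numbering xs -> x != y -> ~~ s x -> ~~ s y ->
  (-1) ^+ prior_red xs x s * (-1) ^+ prior_red xs y (flip s x)
  = - ((-1) ^+ prior_red xs y s * (-1) ^+ prior_red xs x (flip s y)) :> int.
Proof.
move=> num xy sx sy; rewrite !prior_red_flip // !exprD.
have xs_mem z : z \in xs by rewrite (perm_mem num) mem_enum.
have : index x xs != index y xs.
  by apply: contraNneq xy => E; rewrite -(nth_index x (xs_mem x)) E nth_index.
by case: ltngtP => //= _ _; rewrite !(expr0, expr1, mul1r, mulN1r, mulrN, opprK) // mulrC.
Qed.

(** The splittings at two crossings commute, and their signs anticommute. *)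
Lemma differential2_all_plus s : numbering xs -> all_split s ->
    (forall x, ~~ s x -> all_split (flip s x)) ->
  differential xs (differential xs (all_plus s)) = 0.
Proof.
move=> num split_s split_sx; rewrite differential_all_plus // raddf_sum /=.
pose G x y : chain D :=
  \sum_(b : bool) \sum_(b' : bool) two_minus (flip (flip s x) y) (foot x b) (foot y b').
have GC x y : G x y = G y x.
  rewrite /G exchange_big flipC; apply: eq_bigr => b _; apply: eq_bigr => b' _.
  exact: two_minusC.
pose F x y := G x y *~ ((-1) ^+ prior_red xs x s * (-1) ^+ prior_red xs y (flip s x)).
rewrite (eq_bigr (fun x => \sum_(y | ~~ s y && (y != x)) F x y)); last first.
  move=> x sx; rewrite raddfMz raddf_sum /=.
  rewrite (eq_bigr _ (fun b _ => differential_one_minus (foot x b) (split_sx x sx))).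
  rewrite exchange_big /= mulrz_suml; apply: eq_big => [y|y _].
    rewrite flipE; case: eqP => [->|_]; last by rewrite andbT.
    by rewrite andbF /= negbK (negPf sx).
  by rewrite -mulrz_suml /= -mulrzA mulrC.
set S := \sum_(x | _) _.
have SN : S = - S.
  rewrite {1}/S (exchange_big_dep (fun y => ~~ s y)) /=; last by move=> x y _ /andP[].
  rewrite -sumrN; apply: eq_bigr => y sy; rewrite -sumrN.
  apply: eq_big => [x|x /andP[sx /andP[_ yx]]]; first by rewrite eq_sym sy.
  by rewrite /F GC prior_red_swap 1?eq_sym // mulrNz.
by apply: chain_mulr2_eq0; rewrite mulr2n {2}SN subrr.
Qed.

End Chains.
(** * Order two classes *)

Section OrderTwo.

Variables (D : diagram).
Implicit Types (xs : seq (crossing D)) (s : state D) (x y z : crossing D).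
Implicit Types (e t : enhanced_state D) (c : chain D).

(** Taken modulo two, this functional tells the torsion chain from the
    boundaries. *)
Definition mass s c : int := \sum_(t | label t == s) c t.

Lemma mass_sum s (I : finType) (P : pred I) (F : I -> chain D) :
  mass s (\sum_(i | P i) F i) = \sum_(i | P i) mass s (F i).
Proof.
by rewrite /mass exchange_big /=; apply: eq_bigr => t _; rewrite sum_ffunE.
Qed.

Lemma massMz s c n : mass s (c *~ n) = mass s c *~ n.
Proof. by rewrite /mass mulrz_suml; apply: eq_bigr => t _; rewrite ffunMzE. Qed.

Lemma mass_delta s e : mass s (delta e) = (label e == s)%:Z.
Proof.
rewrite /mass; have [Le|Le] := boolP (label e == s).
  rewrite (bigD1 e) //= deltaE eqxx big1 ?addr0 // => t /andP[_ te].
  by rewrite deltaE (negPf te).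
rewrite big1 // => t Lt; rewrite deltaE; case: eqP => // te.
by rewrite -te Lt in Le.
Qed.

Lemma mass_one_minus s s' p : mass s (one_minus s' p) = (s' == s)%:Z.
Proof. by rewrite one_minus.unlock mass_delta. Qed.

Lemma chain_sum_delta c : c = \sum_e delta e *~ c e.
Proof.
apply/ffunP=> t; rewrite sum_ffunE (bigD1 t) //= big1 => [|e et].
  by rewrite ffunMzE deltaE eqxx addr0 -mulrzl mulr1 intz.
by rewrite ffunMzE deltaE eq_sym (negPf et) mul0rz.
Qed.

Lemma adjacent_label x e t : adjacent x e t -> label t x /\ label e = flip (label t) x.
Proof.
case/and5P=> _ _ ex tx /andP[/forallP same _]; split=> //.
apply/ffunP=> y; rewrite flipE; have [->|yx] := eqVneq y x.
  by rewrite tx (negPf ex).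
by have := same y; rewrite yx => /eqP.
Qed.

(** When all the red scars of [s] are bichords, the states next below [s]
    have one circle less. In the j-degree of the enhanced states over [s] with
    one negative circle, they carry positive circles only, so that boundaries
    meet [s] in pairs of enhanced states with the same coefficient. *)
Lemma mass_boundary xs s i c (j := #|red_scars s|%:Z + #|circles s|%:Z - 2) :
  (forall x, s x -> bichord s x) -> homogeneous i j c ->
  exists m, mass s (differential xs c) = m *+ 2.
Proof.
move=> bi_s /forallP hom_c.
rewrite [c]chain_sum_delta raddf_sum mass_sum /=.
suff mass_e e : c e != 0 -> exists m, mass s (differential xs (delta e)) = m *+ 2.
  elim/big_ind: _ => [|_ _ [m ->] [n ->]|e _]; first by exists 0; rewrite mul0rn.
    by exists (m + n); rewrite mulrnDl.
  rewrite raddfMz massMz; have [->|/mass_e[m ->]] := eqVneq (c e) 0.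
    by exists 0; rewrite mulr0z mul0rn.
  by exists (m *~ c e); rewrite !mulrzz mulrnAl.
move=> ce; have /andP[_ /eqP je] := implyP (hom_c e) ce.
have mass_x x : exists m : int, \sum_(t | label t == s) (adjacent x e t)%:Z = m *+ 2.
  have [/andP[sx /eqP Le]|not_below] := boolP (s x && (label e == flip s x)); last first.
    exists 0; rewrite mul0rn big1 // => t /eqP Lt.
    case adj: (adjacent x e t) => //; have [tx Le] := adjacent_label adj.
    by rewrite -Lt tx Le eqxx in not_below.
  have Ee : e = enhance (flip s x) set0.
    apply/eqP; rewrite eq_enhance ?sub0set // Le eqxx -cards_eq0.
    have card_red : #|red_scars s| = #|red_scars (flip s x)|.+1.
      rewrite (cardsD1 x) inE sx; congr _.+1; apply: eq_card => y.
      by rewrite !inE flipE; have [->|] := eqVneq y x; rewrite //= sx.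
    move: je; rewrite /jdegree theta_card /idegree Le /j card_red.
    by rewrite (card_circles_flip sx (bi_s x sx)); lia.
  exists 1; rewrite Ee.
  under eq_bigr => t _ do rewrite (adjacent_all_plus sx (bi_s x sx)).
  rewrite exchange_big /= sum_bool -!/(mass s _) !mass_one_minus eqxx.
  by rewrite mulr2n.
have {mass_x} [m mass_x] := fin_all_exists mass_x.
exists (\sum_x (-1) ^+ prior_red xs x (label e) * m x).
rewrite -sumrMnl /mass.
under eq_bigr => t _ do rewrite differential_delta big_mkcond /=.
rewrite exchange_big /=; apply: eq_bigr => x _; rewrite -mulrnAr -mass_x mulr_sumr.
by apply: eq_bigr => t _; case: ifP => _; rewrite ?mulr1 ?mulr0.
Qed.

(** Order two torsion expressed on chains, so that it can be carried along an
    isomorphism of complexes. *)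
Definition order_two_chain xs i j (V : chain D) :=
  [/\ homogeneous i j V, differential xs V = 0,
      exists2 W, homogeneous (i - 1) j W & differential xs W = V *+ 2 &
      forall c, homogeneous (i - 1) j c -> differential xs c <> V].

Lemma order_two_class xs i j V : order_two_chain xs i j V ->
  exists z : cycles xs i j,
    cycle_val z = V /\ order_two_torsion (homology_class z).
Proof.
case=> homV dV [W homW dW] notB.
have cycV : V \in is_cycle xs i j by rewrite inE homV dV eqxx.
pose z := Cycle cycV; exists z; split=> //.
have class_eq0 (u : cycles xs i j) :
    (homology_class u == 0) = (u \in is_boundary (xs := xs) (i := i) (j := j)).
  by rewrite -[u in RHS]subr0 Quotient.idealrBE /homology_class pi_zeror.
split; first by rewrite class_eq0; apply/boolp.asboolP => -[c homc dc]; case: (notB c).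
have <- : homology_class (z *+ 2) = homology_class z *+ 2 by exact: raddfMn.
by apply/eqP; rewrite class_eq0; apply/boolp.asboolP; exists W.
Qed.

(** * Changing the numbering of the crossings *)

Section Twist.

Variables xs xs' : seq (crossing D).
Hypotheses (num : numbering xs) (num' : numbering xs').

Let inverted y z : bool :=
  (index y xs < index z xs)%N && (index z xs' < index y xs')%N.

Definition inversions s : nat := (\sum_(y | s y) \sum_(z | s z) inverted y z)%N.

Lemma prior_redE ys x s :
  prior_red ys x s = (\sum_(z | s z) (index z ys < index x ys))%N.
Proof.
rewrite /prior_red -sum1dep_card big_mkcondr /=; apply: eq_bigr => z _.
by case: (_ < _)%N.
Qed.

Lemma index_numbering ys y z : numbering ys -> y != z ->
  (index z ys < index y ys)%N = ~~ (index y ys < index z ys)%N.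
Proof.
move=> /perm_mem mem_ys yz; rewrite -leqNgt ltn_neqAle.
have mem x : x \in ys by rewrite mem_ys mem_enum.
case: eqP => // /(congr1 (nth y ys)); rewrite !nth_index // => /eqP.
by rewrite eq_sym (negPf yz).
Qed.

(** A crossing that turns red is inverted with the red crossings which come
    before it in exactly one of the two numberings, so the sign of the
    inversions accounts for the change of sign in the differential. *)
Lemma inversions_flip s x : ~~ s x ->
  odd (inversions (flip s x))
  = odd (inversions s) (+) odd (prior_red xs x s) (+) odd (prior_red xs' x s).
Proof.
move=> sx; have fxx : flip s x x by rewrite flipxx.
have sum_flip F : (\sum_(y | flip s x y) F y = F x + \sum_(y | s y) F y)%N.
  rewrite (bigD1 x) //=; congr addn; apply: eq_bigl => y.
  by rewrite flipE; have [->|] := eqVneq y x; rewrite ?(negPf sx) ?andbT ?andbF.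
have -> : inversions (flip s x) = (\sum_(z | s z) (inverted x z + inverted z x)
    + inversions s)%N.
  rewrite /inversions sum_flip sum_flip {1}/inverted ltnn add0n.
  rewrite (eq_bigr _ (fun y _ => sum_flip _)) !big_split /= addnA.
  by [].
rewrite oddD addbC -addbA; congr addb; rewrite !prior_redE -oddD -big_split /=.
elim/big_rec2: _ => // z m n sz IH; rewrite !oddD -IH !oddb; congr addb.
have xz : x != z by apply: contraNneq sx => ->.
rewrite /inverted (index_numbering num xz) (index_numbering num' xz).
by case: (_ < _)%N; case: (_ < _)%N.
Qed.

Definition twist c : chain D := [ffun e => (-1) ^+ inversions (label e) * c e].

Lemma twistK : involutive twist.
Proof.
by move=> c; apply/ffunP=> e; rewrite !ffunE mulrA -expr2 sqrr_sign mul1r.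
Qed.

Lemma twist_homogeneous i j c : homogeneous i j c -> homogeneous i j (twist c).
Proof.
move/forallP=> hom; apply/forallP=> e; apply/implyP=> nz.
by apply: (implyP (hom e)); apply: contraNneq nz => ce; rewrite ffunE ce mulr0.
Qed.

Lemma differential_twist c :
  differential xs (twist c) = twist (differential xs' c).
Proof.
apply/ffunP=> t; rewrite !ffunE mulr_sumr; apply: eq_bigr => e _.
rewrite mulr_sumr; apply: eq_bigr => x adj; rewrite ffunE !mulrA; congr *%R.
have [tx Le] := adjacent_label adj; have ex := adjacent_blue adj.
have -> : label t = flip (label e) x by rewrite Le flipK.
rewrite -[in RHS]signr_odd inversions_flip // !signr_addb !signr_odd.
by rewrite -[RHS]mulrA -expr2 sqrr_sign mulr1 mulrC.
Qed.

Lemma order_two_twist i j V :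
  order_two_chain xs' i j V -> order_two_chain xs i j (twist V).
Proof.
case=> homV dV [W homW dW] notB; split.
- exact: twist_homogeneous.
- by rewrite differential_twist dV; apply/ffunP=> e; rewrite !ffunE mulr0.
- exists (twist W); first exact: twist_homogeneous.
  rewrite differential_twist dW; apply/ffunP=> e.
  by rewrite ffunMnE [twist V e]ffunE -mulrnAr -ffunMnE [LHS]ffunE.
move=> c homc dc; apply: (notB (twist c)); first exact: twist_homogeneous.
by apply: (inv_inj twistK); rewrite -differential_twist twistK.
Qed.

End Twist.

End OrderTwo.
(** * States in which every ladder is cut *)

Section LadderSystem.

Variables (D : diagram) (s0 : state D) (k : nat) (H : 'I_k -> seq (dart D)).
Hypotheses (H_disc : forall t, ladder_disc s0 (H t)).
Hypothesis H_group :
  perm_eq (ladder_steps H) [seq x <- enum (crossing D) | ~~ s0 x].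
Implicit Types (s : state D) (x y : crossing D) (t u : 'I_k) (d : dart D).

Lemma mem_ladder_steps x : (x \in ladder_steps H) = ~~ s0 x.
Proof. by rewrite (perm_mem H_group) mem_filter mem_enum andbT. Qed.

Lemma uniq_ladder_steps : uniq (ladder_steps H).
Proof. by rewrite (perm_uniq H_group) filter_uniq // enum_uniq. Qed.

Lemma step_blue x t : x \in steps (H t) -> ~~ s0 x.
Proof. exact: ladder_blue. Qed.

Lemma blue_step x : ~~ s0 x -> exists t, x \in steps (H t).
Proof.
by rewrite -mem_ladder_steps => /flatten_mapP[t _ tx]; exists t.
Qed.

Lemma count_ladder_steps (a : pred (crossing D)) :
  count a (ladder_steps H) = (\sum_t count a (steps (H t)))%N.
Proof. by rewrite count_flatten sumnE 2!big_map big_enum. Qed.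

Lemma step_ladder_inj x t u : x \in steps (H t) -> x \in steps (H u) -> t = u.
Proof.
move=> tx ux; apply: contraTeq isT => tu.
have := count_uniq_mem x uniq_ladder_steps.
rewrite count_ladder_steps (bigD1 t) //= (bigD1 u) 1?eq_sym //=.
rewrite !count_uniq_mem ?(ladder_uniq (H_disc _)) // tx ux.
by case: (_ \in _).
Qed.

Definition red_steps s t : nat := count (fun x => s x) (steps (H t)).

Definition above s : bool := [forall x, s0 x ==> s x].

Lemma aboveP s : reflect (forall x, s0 x -> s x) (above s).
Proof. exact: 'forall_implyP. Qed.

(** In these states every blue scar splits a circle when it turns red. *)
Definition cut s : bool := above s && [forall t, (0 < red_steps s t)%N].

Lemma cut_above s : cut s -> above s. Proof. by case/andP. Qed.

Lemma cut_red s t : cut s -> exists2 y, y \in steps (H t) & s y.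
Proof. by case/andP=> _ /forallP/(_ t); rewrite -has_count => /hasP. Qed.

Lemma cut_mono s s' : (forall x, s x -> s' x) -> cut s -> cut s'.
Proof.
move=> ss' /andP[/aboveP s_above /forallP s_cut]; apply/andP; split.
  by apply/aboveP=> x /s_above/ss'.
by apply/forallP=> t; apply: leq_trans (s_cut t) (sub_count _ _) => x /ss'.
Qed.

Lemma flip_mono s x y : ~~ s x -> s y -> flip s x y.
Proof. by move=> sx sy; rewrite flip_neq //; apply: contraNneq sx => <-. Qed.

Lemma cut_flip s x : cut s -> ~~ s x -> cut (flip s x).
Proof. by move=> s_cut sx; apply: cut_mono s_cut => y; apply: flip_mono. Qed.

Lemma cut_red_pair s x : cut s -> ~~ s x ->
  bichord (flip s x) x /\ exists t,
  {in outside (H t) &, forall d d',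
    connect (smoothed_adj s) (inl d) (inl d')
    = connect (smoothed_adj (flip s x)) (inl d) (inl d')}.
Proof.
move=> s_cut sx.
have /blue_step[t tx] : ~~ s0 x by apply: contraNN sx => /(aboveP _ (cut_above s_cut)).
have [y ty sy] := cut_red t s_cut.
have neq_xy : x != y by apply: contraNneq sx => ->.
have fx : flip s x x by rewrite flipxx.
have := ladder_red_pair (H_disc t) tx ty neq_xy fx (flip_mono sx sy).
by rewrite flipK => -[bi_x conn]; split=> //; exists t.
Qed.

Lemma cut_all_split s : cut s -> all_split s.
Proof. by move=> s_cut x sx; case: (cut_red_pair s_cut sx). Qed.

(** A cut state remains cut when blue scars turn red one by one; so quantities
    can be compared with their values at the state with red labels only. *)
Lemma cut_ind (P : state D -> Prop) :
    P [ffun=> true] ->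
    (forall s x, cut s -> ~~ s x -> P (flip s x) -> P s) ->
  forall s, cut s -> P s.
Proof.
move=> P_top P_flip s; have [n] := ubnP #|[set x | ~~ s x]|.
elim: n s => // n IHn s; rewrite ltnS => le_n s_cut.
have [top|[x]] := set_0Vmem [set x | ~~ s x].
  suff -> : s = [ffun=> true] by [].
  by apply/ffunP=> x; rewrite ffunE; have := in_set0 x; rewrite -top inE => /negbFE.
rewrite inE => sx; apply: (P_flip s x) => //; apply: IHn; last exact: cut_flip.
apply: leq_trans le_n; apply/proper_card/properP; split.
  by apply/subsetP=> y; rewrite !inE; apply/contra/flip_mono.
by exists x; rewrite !inE ?flipxx ?negbK.
Qed.

Lemma card_blue_flip s x : ~~ s x ->
  #|[set y | ~~ s y]| = #|[set y | ~~ flip s x y]|.+1.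
Proof.
move=> sx; rewrite (cardsD1 x) inE sx; congr _.+1; apply: eq_card => y.
by rewrite !inE flipE; have [->|] := eqVneq y x; rewrite //= negbK (negPf sx).
Qed.

Lemma card_circles_cut s : cut s ->
  (#|circles s| + #|[set x | ~~ s x]|)%N = #|circles (D := D) [ffun=> true]|.
Proof.
move: s; apply: cut_ind => [|s x s_cut sx <-].
  by rewrite (eq_card0 (A := [set _ | _])) ?addn0 // => x; rewrite !inE ffunE.
rewrite (card_blue_flip sx) addnS -addSn.
rewrite (@card_circles_flip _ (flip s x) x) ?flipK ?flipxx //.
exact: cut_all_split.
Qed.

Lemma outside_ends t u a : a \in [:: opposite_corner (head a (H t)); last a (H t)] ->
  H t != [::] -> outside (H u) a.
Proof.
case E: (H t) => [|b w] // a_end _; have [tu|tu] := eqVneq u t.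
  by rewrite /outside tu E a_end orbT.
rewrite /outside; apply/orP; left; apply: contra_neqN tu => ua.
apply: step_ladder_inj ua _; rewrite E.
have [->|->] : a = opposite_corner b \/ a = last b w.
    by move: a_end; rewrite /= !inE => /orP[]/eqP; [left | right].
  exact: mem_head.
exact: (map_f fst (mem_last b w)).
Qed.

(** Cutting a ladder further splits off an intermediate circle, which touches
    no end of a ladder; so the connection between the two ends of a ladder does
    not depend on the way in which the ladders are cut. *)
Lemma cut_ends s s' t a w : cut s -> cut s' -> H t = a :: w ->
  (circle s (inl (opposite_corner a)) == circle s (inl (last a w)))
  = (circle s' (inl (opposite_corner a)) == circle s' (inl (last a w))).
Proof.
move=> s_cut s'_cut Ht.
have out u : (outside (H u) (opposite_corner a)) && (outside (H u) (last a w)).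
  by rewrite !(@outside_ends t) ?Ht //= !inE eqxx ?orbT.
rewrite !eq_circleE; pose same s := connect (smoothed_adj s)
  (inl (opposite_corner a)) (inl (last a w)).
rewrite -/(same s) -/(same s').
suff top s2 : cut s2 -> same s2 = same [ffun=> true] by rewrite !top.
move: s2; apply: cut_ind => // s2 x s2_cut s2x <-.
have [_ [u conn]] := cut_red_pair s2_cut s2x.
by case/andP: (out u) => ? ?; apply: conn.
Qed.

(** Above a cut state circles only split, so bichords remain bichords. *)
Lemma cut_bichord s s' x : cut s -> (forall y, s y -> s' y) ->
  bichord s x -> bichord s' x.
Proof.
move=> s_cut; have [n] := ubnP #|[set y | s' y && ~~ s y]|.
elim: n s' => // n IHn s'; rewrite ltnS => le_n ss' bi_x.
have [none|[y]] := set_0Vmem [set y | s' y && ~~ s y].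
  suff <- : s = s' by [].
  apply/ffunP=> y; apply/idP/idP => [/ss'//|s'y]; apply: negbNE; apply/negP => sy.
  by have := in_set0 y; rewrite -none inE s'y sy.
rewrite inE => /andP[s'y sy].
have ss'y z : s z -> flip s' y z.
  by move=> sz; rewrite flip_neq ?ss' //; apply: contraNneq sy => <-.
have s'y_cut : cut (flip s' y) by apply: cut_mono s_cut.
have bi_y : bichord s' y.
  by rewrite -[s'](flipK y); apply: cut_all_split => //; rewrite flipxx s'y.
have : bichord (flip s' y) x.
  apply: IHn => //; apply: leq_trans le_n; apply/proper_card/properP; split.
    apply/subsetP=> z; rewrite !inE flipE => /andP[+ sz]; rewrite sz andbT.
    by have [->|] := eqVneq z y; rewrite //= s'y.
  by exists y; rewrite !inE ?flipxx s'y ?sy.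
rewrite !bichord_foot; apply: contraNneq => E; apply/eqP/eq_circleP.
by apply: (flip_connect_sub s'y bi_y); apply/eq_circleP.
Qed.

Lemma card_red_above s : above s ->
  #|red_scars s| = (#|red_scars s0| + \sum_t red_steps s t)%N.
Proof.
move=> /aboveP s_above; rewrite -count_ladder_steps (permP H_group) count_filter.
rewrite -(cardsID (red_scars s0) (red_scars s)); congr (_ + _)%N.
  by apply: eq_card => x; rewrite !inE; apply/andb_idl/s_above.
rewrite -size_filter cardE [in LHS]/enum_mem -enumT.
congr size; apply: eq_filter => x.
by rewrite /= !inE andbC.
Qed.

End LadderSystem.
(** * The chain bounded by twice the torsion chain *)

Lemma telescope_signs (V : zmodType) (T : eqType) (g g' : T -> V) z a r :
  path (fun a b => g' a == g b) a r ->
  \sum_(j < (size r).+1) (g (nth z (a :: r) j) + g' (nth z (a :: r) j)) *~ (-1) ^+ j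
  = g a + g' (last a r) *~ (-1) ^+ size r.
Proof.
elim: r a => [|b r IHr] a /=; first by rewrite big_ord_recl big_ord0 addr0 !mulr1z.
case/andP=> /eqP g'a br; rewrite big_ord_recl /= mulr1z.
under eq_bigr => j _ do rewrite /= exprS mulN1r mulrNz.
by rewrite sumrN IHr // exprS mulN1r mulrNz g'a opprD addrA addrK.
Qed.

Lemma one_minus_circle (D : diagram) (s : state D) p q :
  circle s p = circle s q -> one_minus s p = one_minus s q.
Proof. by rewrite one_minus.unlock => ->. Qed.

Section Levels.

Variables (D : diagram) (s0 : state D) (k : nat) (H : 'I_k -> seq (dart D)).
Hypotheses (H_disc : forall t, ladder_disc s0 (H t)).
Hypothesis H_group :
  perm_eq (ladder_steps H) [seq x <- enum (crossing D) | ~~ s0 x].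
Implicit Types (s : state D) (x y : crossing D) (t u i : 'I_k) (mu : 'I_k -> nat).

(** The states [s(M_1, ..., M_k; )] with [#|M_t| = mu t]. *)
Definition level mu s : bool := above s0 s && [forall t, red_steps H s t == mu t].

Lemma levelP mu s :
  reflect (above s0 s /\ forall t, red_steps H s t = mu t) (level mu s).
Proof.
apply: (iffP andP) => -[s_above counts]; split=> //.
  by move=> t; apply/eqP/(forallP counts).
by apply/forallP=> t; rewrite counts.
Qed.

Lemma level_cut mu s : (forall t, (0 < mu t)%N) -> level mu s -> cut s0 H s.
Proof.
move=> mu_gt0 /levelP[s_above counts]; rewrite /cut s_above.
by apply/forallP=> t; rewrite counts.
Qed.

Lemma size_reds s t : size [seq a <- H t | s a.1] = red_steps H s t.
Proof. by rewrite size_filter /red_steps /steps count_map. Qed.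

Definition bump_at i mu : 'I_k -> nat := fun t => if t == i then (mu t).+1 else mu t.

Lemma level_flip mu s x i : x \in steps (H i) -> s x ->
  level mu (flip s x) = level (bump_at i mu) s.
Proof.
move=> ix sx; have s0x := step_blue H_disc ix.
have above_flip : above s0 (flip s x) = above s0 s.
  apply: eq_forallb => y; rewrite flipE; have [->|//] := eqVneq y x.
  by rewrite (negPf s0x).
have count_flip t : red_steps H s t = (red_steps H (flip s x) t + (t == i))%N.
  rewrite /red_steps; have [->|ti] := eqVneq t i.
    have w_uniq := ladder_uniq (H_disc i).
    have /permP rem_x := perm_to_rem ix; rewrite !rem_x /= flipxx sx addnC.
    congr addn; apply: eq_in_count => y; rewrite mem_rem_uniq // => /andP[yx _].
    by rewrite flip_neq.
  rewrite addn0; apply: eq_in_count => y ty; rewrite flip_neq //.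
  by apply: contraNneq ti => yx; rewrite -yx in ix; apply/eqP/(step_ladder_inj _ _ ty ix).
rewrite /level above_flip; congr andb; apply: eq_forallb => t.
by rewrite count_flip /bump_at; have [_|_] := eqVneq t i; rewrite ?addn1 ?addn0.
Qed.

Lemma sum_ladder_steps (V : zmodType) (P : pred (crossing D)) (F : crossing D -> V) :
  (forall x, P x -> ~~ s0 x) ->
  \sum_(x | P x) F x = \sum_i \sum_(x | (x \in steps (H i)) && P x) F x.
Proof.
move=> P_blue; rewrite (exchange_big_dep P) /=; last by move=> i x _ /andP[].
apply: eq_bigr => x Px; have [i ix] := blue_step H_group (P_blue x Px).
rewrite (big_pred1 i) // => u; rewrite Px andbT; apply/idP/eqP => [ux|->//].
exact: (step_ladder_inj H_disc H_group ux ix).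
Qed.

(** The negative circle is the periphery circle C_i^0. *)
Definition first_minus s i : chain D :=
  if [seq a <- H i | s a.1] is a :: _ then one_minus s (inl (opposite_corner a))
  else 0.

Lemma ladder_chainE mu i : (0 < mu i)%N ->
  ladder_chain s0 H mu i 0 = \sum_(s | level mu s) first_minus s i.
Proof.
move=> mu_gt0; rewrite /ladder_chain.
pose sets s : {ffun 'I_k -> {set crossing D}} :=
  [ffun t => [set x in steps (H t) | s x]].
have red_sets s x : above s0 s -> redden s0 (sets s) x = s x.
  move=> /aboveP s_above; rewrite ffunE.
  apply/orP/idP => [[/s_above//|/existsP[t]]|sx].
    by rewrite ffunE inE => /andP[].
  have [s0x|s0x] := boolP (s0 x); first by left.
  right; have [t tx] := blue_step H_group s0x.
  by apply/existsP; exists t; rewrite ffunE inE tx.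
have card_sets s t : #|sets s t| = red_steps H s t.
  rewrite ffunE /red_steps -size_filter.
  rewrite -(card_uniqP (filter_uniq _ (ladder_uniq (H_disc t)))).
  by apply: eq_card => x; rewrite !inE mem_filter andbC.
rewrite (reindex_onto sets (fun M => redden s0 M)) => [|M /forallP M_ok]; last first.
  apply/ffunP=> t; apply/setP=> x; rewrite ffunE inE ffunE.
  have [tx|t'x] := boolP (x \in steps (H t)); last first.
    by have /andP[/subsetP/(_ x)/contraNF-> //] := M_ok t.
  rewrite (negPf (step_blue H_disc tx)) /=;
  apply/existsP/idP => [[u ux]|]; last by exists t.
  have /andP[/subsetP/(_ x ux) ux' _] := M_ok u.
  by rewrite (step_ladder_inj H_disc H_group tx ux').
have sets_level s : [forall t, (sets s t \subset steps (H t)) && (#|sets s t| == mu t)]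
    && (redden s0 (sets s) == s) = level mu s.
  apply/andP/levelP => [[/forallP s_ok /eqP Es]|[s_above counts]].
    split; first by apply/aboveP=> x s0x; rewrite -Es ffunE s0x.
    by move=> t; have /andP[_ /eqP <-] := s_ok t; rewrite card_sets.
  split; last by apply/eqP/ffunP=> x; apply: red_sets.
  apply/forallP=> t; rewrite card_sets counts eqxx andbT ffunE.
  by apply/subsetP=> x; rewrite inE => /andP[].
apply: eq_big => // s s_ok; have s_level := s_ok; rewrite sets_level in s_level.
have /andP[_ /eqP ->] := s_ok; rewrite /first_minus /ladder_circle.
have -> : [seq a <- H i | a.1 \in sets s i] = [seq a <- H i | s a.1].
  by apply: eq_in_filter => a ia; rewrite ffunE inE map_f.
have := size_reds s i; have /levelP[_ ->] := s_level.
case: [seq _ <- _ | _] => [|a r] /=; last by rewrite one_minus.unlock.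
by move=> mu0; rewrite -mu0 in mu_gt0.
Qed.

(** The sign of a step depends on the number of red steps in the previous
    ladders, and on its rank among the red steps of its own ladder. *)
Section Signs.

Variable xs : seq (crossing D).
Hypotheses (num : numbering xs) (xs_prefix : prefix (ladder_steps H) xs).

Lemma prior_red_count s x :
  prior_red xs x s = count (fun y => s y) (take (index x xs) xs).
Proof.
have xs_uniq : uniq xs by rewrite (perm_uniq num) enum_uniq.
have xs_mem y : y \in xs by rewrite (perm_mem num) mem_enum.
rewrite /prior_red -size_filter.
rewrite -(card_uniqP (filter_uniq _ (take_uniq _ xs_uniq))).
by apply: eq_card => y; rewrite inE mem_filter in_take.
Qed.

Lemma ladder_steps_split i : exists l, ladder_steps H =
  flatten [seq steps (H t) | t <- take i (enum 'I_k)] ++ steps (H i) ++ l.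
Proof.
exists (flatten [seq steps (H t) | t <- drop i.+1 (enum 'I_k)]).
rewrite /ladder_steps -{1}(cat_take_drop i (enum 'I_k)) map_cat flatten_cat.
by rewrite (drop_nth i) ?size_enum_ord // nth_ord_enum.
Qed.

Lemma count_previous_ladders s i :
  count (fun x => s x) (flatten [seq steps (H t) | t <- take i (enum 'I_k)])
  = (\sum_(t < k | (t < i)%N) red_steps H s t)%N.
Proof.
rewrite count_flatten sumnE 2!big_map big_uniq ?take_uniq ?enum_uniq //.
by apply: eq_bigl => t; rewrite in_take ?mem_enum // index_enum_ord.
Qed.

Lemma prior_red_step s i j z (r := [seq a <- H i | s a.1])
    (x := (nth z r j).1) : (j < size r)%N ->
  prior_red xs x (flip s x) = (\sum_(t < k | (t < i)%N) red_steps H s t + j)%N.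
Proof.
move=> ltj; set a := nth z r j.
have r_a : a \in r by apply: mem_nth.
have /andP[sa i_a] : s a.1 && (a \in H i) by rewrite mem_filter in r_a.
have [l def_steps] := ladder_steps_split i.
have /prefixP[xs' def_xs] := xs_prefix.
have xs_uniq : uniq xs by rewrite (perm_uniq num) enum_uniq.
have [w1 [w2 def_w]] : exists w1 w2, H i = w1 ++ a :: w2.
  by case/splitPr: i_a => w1 w2; exists w1, w2.
pose pre := flatten [seq steps (H t) | t <- take i (enum 'I_k)] ++ steps w1.
have def_pre : xs = pre ++ x :: (steps w2 ++ l ++ xs').
  by rewrite def_xs def_steps def_w /steps map_cat /= -!catA.
have pre'x : x \notin pre.
  by move: xs_uniq; rewrite def_pre uniq_catC /= mem_cat negb_or => /andP[/andP[_ ->]].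
rewrite prior_red_count def_pre take_pivot //.
have -> : count (fun y => flip s x y) pre = count (fun y => s y) pre.
  by apply: eq_in_count => y pre_y; rewrite flip_neq //; apply: contraNneq pre'x => <-.
rewrite count_cat count_previous_ladders; congr addn.
have r_uniq : uniq r by rewrite filter_uniq // (map_uniq (ladder_uniq (H_disc i))).
have def_r : r = [seq b <- w1 | s b.1] ++ a :: [seq b <- w2 | s b.1].
  by rewrite /r def_w filter_cat /= sa.
rewrite count_map -size_filter -[RHS](index_uniq z ltj r_uniq) -/a def_r.
rewrite index_cat /= eqxx addn0 ifN //.
by move: r_uniq; rewrite def_r uniq_catC /= mem_cat negb_or => /andP[/andP[_ ->]].
Qed.

(** The circles between consecutive red steps of a ladder cancel in pairs;
    there remain the circles touching the ends of the ladder, which coincide. *)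
Lemma sum_red_steps s i a w : H i = a :: w -> (0 < red_steps H s i)%N ->
    circle s (inl (opposite_corner a)) = circle s (inl (last a w)) ->
  \sum_(x | (x \in steps (H i)) && s x)
    (\sum_(b : bool) one_minus s (foot x b)) *~ (-1) ^+ prior_red xs x (flip s x)
  = first_minus s i *~ ((-1) ^+ (\sum_(t < k | (t < i)%N) red_steps H s t)%N
                        * (1 - (-1) ^+ red_steps H s i)).
Proof.
move=> Hi red_gt0 ends.
set r := [seq b <- H i | s b.1]; set N := (\sum_(t < k | _) _)%N.
pose front (b : dart D) := one_minus s (inl b).
pose behind (b : dart D) := one_minus s (inl (opposite_corner b)).
have feet b : b \in r -> \sum_e one_minus s (foot b.1 e) = behind b + front b.
  case: b => x p; rewrite mem_filter => /andP[/= sx ip].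
  have [e [E1 E2]] := red_corner_foot sx (ladder_odd (H_disc i) ip).
  rewrite /front /behind /opposite_corner /= (one_minus_circle E1).
  by rewrite (one_minus_circle E2) sum_bool; case: (e); rewrite // addrC.
have -> : \sum_(x | (x \in steps (H i)) && s x)
    (\sum_b one_minus s (foot x b)) *~ (-1) ^+ prior_red xs x (flip s x)
  = \sum_(b <- r) (behind b + front b) *~ (-1) ^+ prior_red xs b.1 (flip s b.1).
  have r_uniq : uniq [seq b.1 | b <- r].
    by apply: subseq_uniq (ladder_uniq (H_disc i)); apply/map_subseq/filter_subseq.
  transitivity (\sum_(x <- [seq b.1 | b <- r])
      (\sum_b one_minus s (foot x b)) *~ (-1) ^+ prior_red xs x (flip s x)).
    rewrite big_uniq //; apply: eq_bigl => x; apply/andP/mapP.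
      by case=> /mapP[b ib ->] sb; exists b; rewrite // mem_filter sb.
    by case=> b; rewrite mem_filter => /andP[sb ib] ->; rewrite map_f.
  by rewrite big_map; apply: eq_big_seq => b /feet->.
rewrite (big_nth a) big_mkord.
rewrite (eq_bigr (fun j : 'I_(size r) =>
    (behind (nth a r j) + front (nth a r j)) *~ (-1) ^+ j *~ (-1) ^+ N)); last first.
  by move=> j _; rewrite prior_red_step // -mulrzA -exprD addnC.
rewrite -mulrz_suml.
have := consecutive_reds s (H_disc i); rewrite -/r.
have := first_red_behind (s := s) (H_disc i) a; rewrite -/r.
have := last_red_front (s := s) (H_disc i) a; rewrite -/r.
have := size_reds s i; rewrite -/r /first_minus -/r.
case: r {feet} => [|b r] /=; first by move=> red0; rewrite -red0 in red_gt0.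
move=> size_r /(_ isT) last_r /(_ isT) first_r consec.
rewrite telescope_signs; last first.
  apply: sub_path consec => c d /eqP cd; apply/eqP/one_minus_circle; exact: cd.
have -> : front (last b r) = behind b.
  by apply: one_minus_circle; rewrite last_r first_r Hi /= ends.
rewrite -size_r exprS mulN1r opprK -[X in X + _]mulr1z -mulrzDr -mulrzA mulrC //.
Qed.

(** This is the chain [s(mu_1, ..., mu_k; )]. *)
Definition plus_chain mu : chain D := \sum_(s | level mu s) all_plus s.

Definition one_periphery s := forall t a w, H t = a :: w ->
  circle s (inl (opposite_corner a)) = circle s (inl (last a w)).

Hypothesis cut_periphery : forall s, cut s0 H s -> one_periphery s.

Lemma bump_gt0 i mu : (forall t, (0 < mu t)%N) -> forall t, (0 < bump_at i mu t)%N.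
Proof. by move=> mu_gt0 t; rewrite /bump_at; case: eqP. Qed.

(** A state one step above the level [mu] comes from it by a step of the one
    ladder whose number of red steps has increased. *)
Lemma differential_level mu : (forall t, (0 < mu t)%N) ->
  differential xs (plus_chain mu)
  = \sum_i ladder_chain s0 H (bump_at i mu) i 0
      *~ ((-1) ^+ (\sum_(t < k | (t < i)%N) mu t)%N * (1 + (-1) ^+ mu i)).
Proof.
move=> mu_gt0; rewrite /plus_chain raddf_sum /=.
pose G s x : chain D := (\sum_(b : bool) one_minus s (foot x b))
  *~ (-1) ^+ prior_red xs x (flip s x).
transitivity (\sum_(s : state D) \sum_(x | s x && level mu (flip s x)) G s x).
  rewrite (eq_bigr _ (fun s lev => differential_all_plus xs
    (cut_all_split H_disc H_group (level_cut mu_gt0 lev)))).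
  rewrite (exchange_big_dep predT) // [RHS](exchange_big_dep predT) //=.
  apply: eq_bigr => x _.
  rewrite (reindex_inj (inv_inj (flipK x))) /=; apply: eq_big => s.
    by rewrite flipxx negbK andbC.
  by rewrite /G flipK.
transitivity (\sum_(s : state D) \sum_i
    \sum_(x | (x \in steps (H i)) && (s x && level mu (flip s x))) G s x).
  apply: eq_bigr => s _; apply: sum_ladder_steps => x.
  case/andP=> sx /levelP[/aboveP fs_above _].
  by apply/negP => /fs_above; rewrite flipxx sx.
rewrite exchange_big /=; apply: eq_bigr => i _.
rewrite ladder_chainE ?bump_gt0 // mulrz_suml [RHS]big_mkcond /=.
apply: eq_bigr => s _; case: ifP => [lev|not_lev].
  have [s_above counts] := levelP _ _ lev.
  have bmu := bump_gt0 i mu_gt0.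
  case Hi: (H i) => [|a w]; first by case/and4P: (H_disc i); rewrite Hi.
  have periph := cut_periphery (level_cut bmu lev) Hi.
  rewrite -Hi (eq_bigl (fun x => (x \in steps (H i)) && s x)); last first.
    move=> x; case ix: (x \in _) => //=; case sx: (s x) => //=.
    by rewrite (level_flip _ ix).
  rewrite (sum_red_steps Hi _ periph) counts ?bmu // /bump_at eqxx exprS mulN1r opprK.
  congr (_ *~ (_ ^+ _ * _)); apply: eq_bigr => t ti; rewrite counts /bump_at.
  by case: eqP ti => // ->; rewrite ltnn.
rewrite big_pred0 // => x; apply/negP => /and3P[ix sx].
by rewrite (level_flip _ ix) // not_lev.
Qed.

Lemma red_steps_max s t : (red_steps H s t <= height (H t))%N.
Proof. by rewrite -size_reds size_filter count_size. Qed.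

Lemma differential_plus_chain mu : (forall t, (0 < mu t)%N) ->
  differential xs (plus_chain mu) = torsion_chain s0 H mu *+ 2.
Proof.
move=> mu_gt0; rewrite differential_level // /torsion_chain -sumrMnl.
rewrite [RHS]big_mkcond /=; apply: eq_bigr => i _.
rewrite -(signr_odd _ (mu i)); case: ifP => [/andP[/negPf-> _]|].
  by rewrite expr0 mulrzA [RHS]pmulrn.
move/negbT; rewrite negb_and negbK => /orP[->|]; first by rewrite expr1 subrr mulr0.
rewrite -leqNgt => full; rewrite ladder_chainE ?bump_gt0 //.
rewrite [\sum_(s | level _ s) _]big_pred0 ?mul0rz // => s.
apply/negP => /levelP[_ /(_ i)]; rewrite /bump_at eqxx => red_i.
by have := leq_trans (red_steps_max s i) full; rewrite red_i ltnn.
Qed.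

Lemma torsion_chain_cycle mu : (forall t, (0 < mu t)%N) ->
  differential xs (torsion_chain s0 H mu) = 0.
Proof.
move=> mu_gt0; apply: chain_mulr2_eq0.
rewrite -raddfMn /= -differential_plus_chain // /plus_chain !raddf_sum big1 // => s lev.
have s_cut := level_cut mu_gt0 lev.
apply: differential2_all_plus => // [|x sx]; first exact: cut_all_split s_cut.
by apply: (cut_all_split H_disc H_group); apply: cut_flip.
Qed.

End Signs.

End Levels.
(** * The torsion class *)

Section Homogeneous.

Variables (D : diagram) (i j : int).
Implicit Types (c : chain D) (e : enhanced_state D).

Lemma homogeneous_delta e : idegree e = i -> jdegree e = j ->
  homogeneous i j (delta e).
Proof.
move=> <- <-; apply/forallP=> t; rewrite deltaE; apply/implyP.
by case: (t =P e) => // ->; rewrite !eqxx.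
Qed.

Lemma homogeneousMz c n : homogeneous i j c -> homogeneous i j (c *~ n).
Proof.
move/forallP=> hom; apply/forallP=> e; apply/implyP=> nz.
by apply: (implyP (hom e)); apply: contraNneq nz => ce; rewrite ffunMzE ce mul0rz.
Qed.

Lemma homogeneous_sum (I : finType) (P : pred I) (F : I -> chain D) :
  (forall x, P x -> homogeneous i j (F x)) -> homogeneous i j (\sum_(x | P x) F x).
Proof.
have [hom0 homB] := @homogeneous_closed D i j.
move=> homF; apply: (big_ind (homogeneous i j)) => // c c' hc hc'.
by rewrite -[c']opprK; apply: (homB) => //; rewrite -sub0r; apply: homB.
Qed.

End Homogeneous.

Section Torsion.

Variables (D : diagram) (s0 : state D) (k : nat) (H : 'I_k -> seq (dart D)).
Hypotheses (H_disc : forall t, ladder_disc s0 (H t)).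
Hypothesis H_group :
  perm_eq (ladder_steps H) [seq x <- enum (crossing D) | ~~ s0 x].
Variable f : 'I_k -> crossing D.
Hypothesis f_steps : forall t, f t \in steps (H t).
Implicit Types (s : state D) (x y : crossing D) (t u : 'I_k) (mu : 'I_k -> nat).

Let s1 := redden s0 (fun t => [set f t]).
Let i0 := #|red_scars s0|.

Lemma red1E x t : x \in steps (H t) -> s1 x = (x == f t).
Proof.
move=> tx; rewrite ffunE (negPf (step_blue H_disc tx)) /=.
apply/existsP/eqP => [[u]|->]; last by exists t; rewrite inE.
by rewrite inE => /eqP xf; rewrite (step_ladder_inj H_disc H_group tx (u := u)) // xf.
Qed.

Lemma red1_steps t : red_steps H s1 t = 1%N.
Proof.
transitivity (count_mem (f t) (steps (H t))).
  by apply: eq_in_count => x tx; rewrite (red1E tx).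
by rewrite count_uniq_mem ?(ladder_uniq (H_disc t)) // f_steps.
Qed.

Lemma red1_above : above s0 s1.
Proof. by apply/aboveP=> x s0x; rewrite ffunE s0x. Qed.

Lemma red1_cut : cut s0 H s1.
Proof. by rewrite /cut red1_above; apply/forallP=> t; rewrite red1_steps. Qed.

Lemma card_red_blue s : (#|red_scars s| + #|[set x | ~~ s x]|)%N = #|crossing D|.
Proof.
rewrite -cardsT -(cardsID (red_scars s) setT) setTI; congr addn.
by apply: eq_card => x; rewrite !inE andbT.
Qed.

(** Each further red step adds one circle, starting from [s1] which has one
    red step in each of the [k] ladders. *)
Lemma card_circles_level mu s : (forall t, (0 < mu t)%N) -> level s0 H mu s ->
  (#|circles s| + k = #|circles s1| + \sum_t mu t)%N.
Proof.
move=> mu_gt0 lev; have [s_above counts] := levelP _ _ _ _ lev.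
have := card_circles_cut H_disc H_group (level_cut mu_gt0 lev).
have := card_circles_cut H_disc H_group red1_cut.
have := card_red_blue s; have := card_red_blue s1.
rewrite (card_red_above H_group s_above) (card_red_above H_group red1_above).
rewrite (eq_bigr _ (fun t _ => counts t)) (eq_bigr _ (fun t _ => red1_steps t)).
rewrite sum1_card card_ord -/i0 -/s1; move: (\sum_t mu t)%N #|circles s| #|circles s1|.
move: #|circles _| #|[set _ | ~~ s _]| #|[set _ | ~~ s1 _]| #|crossing D| i0.
by lia.
Qed.

Lemma idegree_level mu s e : level s0 H mu s -> label e = s ->
  idegree e = (i0 + \sum_t mu t)%N.
Proof.
case/levelP=> s_above counts Le; rewrite /idegree Le (card_red_above H_group s_above).
by rewrite (eq_bigr _ (fun t _ => counts t)).
Qed.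

Lemma jdegree_level mu s e : (forall t, (0 < mu t)%N) ->
    level s0 H mu s -> label e = s ->
  jdegree e = (i0 + #|circles s1| + 2 * \sum_t mu t)%N%:Z - k%:Z
              - (#|minus_circles e| * 2)%N%:Z.
Proof.
move=> mu_gt0 lev Le; rewrite /jdegree (idegree_level lev Le) theta_card Le.
by have := card_circles_level mu_gt0 lev; lia.
Qed.

Lemma sum_bump_at i mu : (\sum_t bump_at i mu t = (\sum_t mu t).+1)%N.
Proof.
rewrite (bigD1 i) //= [in RHS](bigD1 i) //= /bump_at eqxx addSn; congr (_ + _).+1.
by apply: eq_bigr => t /negPf->.
Qed.

Lemma homogeneous_plus_chain mu : (forall t, (0 < mu t)%N) ->
  homogeneous (i0 + \sum_t mu t)%N%:Z
    ((i0 + #|circles s1| + 2 * \sum_t mu t)%N%:Z - k%:Z) (plus_chain s0 H mu).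
Proof.
move=> mu_gt0; apply: homogeneous_sum => s lev; apply: homogeneous_delta.
  exact: idegree_level lev _.
by rewrite (jdegree_level mu_gt0 lev) // minus_enhance ?sub0set // cards0 subr0.
Qed.

Lemma first_minusP s i : (0 < red_steps H s i)%N ->
  exists p, first_minus H s i = one_minus s p.
Proof.
rewrite -size_reds /first_minus; case: [seq _ <- _ | _] => // a r _.
by exists (inl (opposite_corner a)).
Qed.

Lemma homogeneous_torsion_chain mu : (forall t, (0 < mu t)%N) ->
  homogeneous (i0 + 1 + \sum_t mu t)%N%:Z
    ((i0 + #|circles s1| + 2 * \sum_t mu t)%N%:Z - k%:Z) (torsion_chain s0 H mu).
Proof.
move=> mu_gt0; apply: homogeneous_sum => i _; apply: homogeneousMz.
have bmu := bump_gt0 i mu_gt0.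
rewrite -/(bump_at i mu) ladder_chainE //; apply: homogeneous_sum => s lev.
have [_ counts] := levelP _ _ _ _ lev.
have [|p ->] := @first_minusP s i; first by rewrite counts.
rewrite one_minus.unlock; apply: homogeneous_delta.
  by rewrite (idegree_level lev) // sum_bump_at; lia.
rewrite (jdegree_level bmu lev) // sum_bump_at.
by rewrite minus_enhance ?sub1set ?circle_in // cards1; lia.
Qed.

(** Among the states of a level, those above [s1] inherit its bichords. *)
Lemma level_above_red1 mu : (forall t, (0 < mu t <= height (H t))%N) ->
  exists2 s, level s0 H mu s & forall x, s1 x -> s x.
Proof.
move=> mu_bounds.
pose L t := f t :: take (mu t).-1 (rem (f t) (steps (H t))).
have L_sub t : {subset L t <= steps (H t)}.
  by move=> x; rewrite inE => /predU1P[->//|/mem_take/mem_rem].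
have L_uniq t : uniq (L t).
  have w_uniq := ladder_uniq (H_disc t).
  rewrite /= take_uniq ?rem_uniq // andbT.
  by apply/negP => /mem_take; rewrite mem_rem_uniqF.
have L_size t : size (L t) = mu t.
  have /andP[mu_gt0 mu_le] := mu_bounds t.
  rewrite /= size_takel ?prednK // size_rem // size_map.
  by rewrite -!subn1 leq_sub2r.
pose s : state D := [ffun x => s0 x || [exists t, x \in L t]].
have sE t x : x \in steps (H t) -> s x = (x \in L t).
  move=> tx; rewrite ffunE (negPf (step_blue H_disc tx)) /=.
  apply/existsP/idP => [[u ux]|]; last by exists t.
  by rewrite (step_ladder_inj H_disc H_group tx (L_sub u x ux)).
exists s; last first.
  move=> x; rewrite !ffunE => /orP[->//|/existsP[t]].
  by rewrite inE => /eqP->; apply/orP; right; apply/existsP; exists t; rewrite mem_head.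
apply/levelP; split; first by apply/aboveP=> x s0x; rewrite ffunE s0x.
move=> t; rewrite -(L_size t) /red_steps (eq_in_count (sE t)) -size_filter.
apply/perm_size/uniq_perm; rewrite ?filter_uniq ?(ladder_uniq (H_disc t)) //.
by move=> x; rewrite mem_filter; apply/andb_idr/L_sub.
Qed.

Hypothesis red_bichords : forall x, s0 x -> bichord s1 x.

(** A red step of a ladder is a bichord as soon as it is not the only one. *)
Lemma level_bichords mu s : (forall t, (2 <= mu t)%N) -> level s0 H mu s ->
  (forall x, s1 x -> s x) -> forall x, s x -> bichord s x.
Proof.
move=> mu_ge2 /levelP[_ counts] s1s x sx.
have [s0x|/(blue_step H_group)[t tx]] := boolP (s0 x).
  by apply: cut_bichord red1_cut s1s _ => //; apply: red_bichords.
have [y /and3P[ty xy sy]] : exists y, [&& y \in steps (H t), x != y & s y].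
  apply/existsP; apply: contraTT (mu_ge2 t) => /existsPn none; rewrite -counts.
  have -> : red_steps H s t = count_mem x (steps (H t)).
    apply: eq_in_count => y ty; apply/idP/eqP => [sy|->//].
    by have := none y; rewrite ty sy andbT negbK => /eqP.
  by rewrite count_uniq_mem ?(ladder_uniq (H_disc t)) // tx.
by have [] := ladder_red_pair (H_disc t) tx ty xy sx sy.
Qed.

(** The numbers of red steps of a state tell which ladder has got an additional
    one, so that only one summand of the torsion chain meets the state [s]. *)
Lemma mass_torsion_chain mu r s : (forall t, (0 < mu t)%N) ->
    ~~ odd (mu r) -> (mu r < height (H r))%N -> level s0 H (bump_at r mu) s ->
  mass s (torsion_chain s0 H mu) = (-1) ^+ (\sum_(t < k | (t < r)%N) mu t)%N.
Proof.
move=> mu_gt0 even_r lt_r lev; rewrite /torsion_chain mass_sum.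
have [_ counts] := levelP _ _ _ _ lev.
have mass_i i : mass s (ladder_chain s0 H (bump_at i mu) i 0) = (i == r)%:Z.
  have bmu := bump_gt0 i mu_gt0.
  rewrite ladder_chainE // mass_sum.
  have mass_s s' : level s0 H (bump_at i mu) s' ->
      mass s (first_minus H s' i) = (s' == s)%:Z.
    move=> lev'; have [_ counts'] := levelP _ _ _ _ lev'.
    by have [|p ->] := @first_minusP s' i; rewrite ?counts' // mass_one_minus.
  rewrite (eq_bigr _ mass_s).
  have [->|neq_ir] := eqVneq i r.
    rewrite (bigD1 s) //= eqxx big1 ?addr0 // => s' /andP[_ /negPf->] //.
  rewrite big1 // => s' lev'; case: eqP => // Es.
  have [_ /(_ r)] := levelP _ _ _ _ lev'; rewrite Es counts /bump_at eqxx.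
  by rewrite eq_sym (negPf neq_ir) => /eqP; rewrite eqn_leq ltnn.
rewrite (eq_bigr (fun i => (i == r)%:Z *~ (-1) ^+ (\sum_(t < k | (t < i)%N) mu t)%N));
  last by move=> i _; rewrite massMz; congr (_ *~ _); exact: mass_i.
rewrite (bigD1 r) /= ?even_r // eqxx mulrzz mul1r [X in _ + X]big1 ?addr0 // => i.
by case/andP=> _ /negPf->; rewrite mul0rz.
Qed.

Variable xs : seq (crossing D).
Hypotheses (num : numbering xs) (xs_prefix : prefix (ladder_steps H) xs).
Hypothesis H_periphery : forall t, periphery_number s1 (H t) = 1%N.

Lemma level_periphery s : cut s0 H s -> one_periphery H s.
Proof.
move=> s_cut t a w Ht; apply/eqP; rewrite (cut_ends H_disc H_group s_cut red1_cut Ht).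
by have := H_periphery t; rewrite /periphery_number Ht /= cards2; case: eqP.
Qed.

Lemma torsion_chain_order_two mu (i : int := (i0 + 1 + \sum_(t < k) mu t)%N%:Z)
    (j : int := (i0 + #|circles s1| + 2 * \sum_(t < k) mu t)%N%:Z - k%:Z) :
  (forall t, (2 <= mu t <= height (H t))%N) ->
  (exists r, ~~ odd (mu r) /\ (mu r < height (H r))%N) ->
  order_two_chain xs i j (torsion_chain s0 H mu).
Proof.
move=> mu_bounds [r [even_r lt_r]].
have mu_ge2 t : (2 <= mu t)%N by case/andP: (mu_bounds t).
have mu_gt0 t : (0 < mu t)%N := ltnW (mu_ge2 t).
have i1 : i - 1 = (i0 + \sum_t mu t)%N%:Z by rewrite /i addnAC PoszD addrK.
split.
- exact: homogeneous_torsion_chain.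
- exact: (torsion_chain_cycle H_disc H_group num xs_prefix level_periphery).
- exists (plus_chain s0 H mu); first by rewrite i1; apply: homogeneous_plus_chain.
  exact: (differential_plus_chain H_disc H_group num xs_prefix level_periphery).
move=> c hom_c dc.
have [|s lev s1s] := @level_above_red1 (bump_at r mu).
  move=> t; rewrite bump_gt0 //= /bump_at; case: eqP => [->//|_].
  by case/andP: (mu_bounds t).
have bmu_ge2 t : (2 <= bump_at r mu t)%N.
  by rewrite /bump_at; case: eqP => _; rewrite ?leqW.
have bi_s := level_bichords bmu_ge2 lev s1s.
have Ej : j = #|red_scars s|%:Z + #|circles s|%:Z - 2.
  have := card_circles_level (fun t => ltnW (bmu_ge2 t)) lev.
  have [s_above counts] := levelP _ _ _ _ lev.
  rewrite (card_red_above H_group s_above) (eq_bigr _ (fun t _ => counts t)).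
  by rewrite sum_bump_at /j -/i0; lia.
rewrite Ej in hom_c; have [m] := mass_boundary xs bi_s hom_c.
rewrite dc (mass_torsion_chain mu_gt0 even_r lt_r lev) -signr_odd.
by case: odd; rewrite ?expr0 ?expr1 mulr2n; lia.
Qed.

End Torsion.

Theorem theorem8 (D : diagram) (o : orientation D) (s0 : state D) (k : nat)
    (H : 'I_k -> seq (dart D)) (f : 'I_k -> crossing D)
    (s1 := redden s0 (fun t => [set f t]))
    (i0 := #|red_scars s0|)
    (H_ladders : forall t, ladder s0 (H t))
    (H_group_blue_scars :
       perm_eq (ladder_steps H) [seq x <- enum (crossing D) | ~~ s0 x])
    (H_heights : forall t, (2 <= height (H t))%N)
    (f_steps : forall t, f t \in steps (H t))
    (H_periphery : forall t, periphery_number s1 (H t) = 1%N)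
    (H_height3 : exists l, (3 <= height (H l))%N)
    (red_bichords : forall x, s0 x -> bichord s1 x) :
  (forall xs : seq (crossing D), numbering xs ->
     exists (h q : int) (z : Kh o xs h q), order_two_torsion z)
  /\
  (forall xs : seq (crossing D), numbering xs -> prefix (ladder_steps H) xs ->
     forall mu : 'I_k -> nat,
       (forall t, (2 <= mu t <= height (H t))%N) ->
       (exists r, ~~ odd (mu r) /\ (mu r < height (H r))%N) ->
       let i : int := (i0 + 1 + \sum_(t < k) mu t)%N%:Z in
       let j : int :=
         (i0 + #|circles s1| + 2 * \sum_(t < k) mu t)%N%:Z - k%:Z in
       exists V : cycles xs i j,
         cycle_val V = torsion_chain s0 H mu
         /\ order_two_torsion (homology_class V)).
Proof.
have H_disc t : ladder_disc s0 (H t) by case/andP: (H_ladders t).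
have order2 xs : numbering xs -> prefix (ladder_steps H) xs -> _ :=
  fun num pre => torsion_chain_order_two H_disc H_group_blue_scars f_steps
    red_bichords num pre H_periphery.
split=> [xs num|xs num pre mu mu_bounds mu_even i j]; last first.
  by apply: order_two_class; apply: order2.
(* The numbering ys starts with the ladders. With mu_t = 2 for all t, the ladder
   l has an even number of red steps, and at least one blue step. *)
pose ys := ladder_steps H ++ [seq x <- enum (crossing D) | s0 x].
have num_ys : numbering ys.
  rewrite /numbering /ys perm_catC perm_sym -(perm_filterC (fun x => s0 x)).
  by rewrite perm_cat2l perm_sym.
have [l l_ge3] := H_height3.
pose S := (\sum_(t < k) 2)%N.
have order2V : order_two_chain ys (i0 + 1 + S)%N%:Z
    ((i0 + #|circles s1| + 2 * S)%N%:Z - k%:Z) (torsion_chain s0 H (fun=> 2)).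
  apply: (order2 ys num_ys (prefix_prefix _ _) (fun=> 2)) => [t|].
    by rewrite H_heights.
  by exists l.
exists ((i0 + 1 + S)%N%:Z - (nneg o)%:Z).
exists ((i0 + #|circles s1| + 2 * S)%N%:Z - k%:Z + (npos o)%:Z - (nneg o)%:Z *+ 2).
rewrite /Kh; have := order_two_twist num num_ys order2V.
set V := twist _ _ _; set h := _ + (nneg o)%:Z; set q := _ + (nneg o)%:Z *+ 2.
have <- : h = (i0 + 1 + S)%N%:Z by rewrite /h subrK.
have <- : q = (i0 + #|circles s1| + 2 * S)%N%:Z - k%:Z.
  by rewrite /q addrAC subrK addrK.
by case/order_two_class=> z [_ z_order2]; exists (homology_class z).
Qed.
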